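(* Let $R=\mathbb{Z}$ or $\mathbb{F}_p$ ($p$ a prime), let $X$ be a set, and let $\tau\colon X\to \mathsf{T}^2_R(X)$ be a map of sets. If $\tau$ is admissible, then $d_\tau^2\equiv 0$, and the map $\mathsf{T}^1_R(X)\to C^1(\Delta(M_\tau);R)$ given by $q\mapsto(\mathbf{a}\mapsto q(\mathbf{a}))$ extends uniquely to a monomorphism $$\psi_X\colon (\mathsf{T}_R(X),d_\tau)\hookrightarrow (C^*(\Delta(M_\tau);R),d_\Delta)$$ of binomial cup-one dgas.
   Context: Free binomial algebra. For a set $X$, $\mathrm{Int}(\mathbb{Z}^X)=\{q\in\mathbb{Q}[X] : q(\mathbb{Z}^X)\subseteq\mathbb{Z}\}$, and $\mathrm{Int}(\mathbb{F}_p^X)$ is the quotient of $\mathrm{Int}(\mathbb{Z}^X)$ by the ideal generated by $\zeta_n(x)=\binom{x}{n}$ ($x\in X$, $n\ge p$), tensored with $\mathbb{F}_p$. Let $\mathfrak{m}_{X,R}\subset \mathrm{Int}(R^X)$ be the submodule of polynomials with zero constant term, and $\mathsf{T}_R(X)=T^*(\mathfrak{m}_{X,R})$ the tensor algebra over $R$, with product $\cup=\otimes$ and maps $a\cup_1 b=ab$ on $\mathsf{T}^1=\mathfrak{m}_{X,R}$, $(a\otimes b)\cup_1 c=ac\otimes b+a\otimes bc$, and $(a_1\otimes a_2)\circ(b_1\otimes b_2)=a_1b_1\otimes a_2b_2$. The map $d_\tau$. For every set map $\tau\colon X\to\mathsf{T}_R^2(X)$, $d_\tau\colon\mathsf{T}_R(X)\to\mathsf{T}_R(X)$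 denotes the unique degree-1 $R$-linear map with $d_\tau(x)=\tau(x)$ for $x\in X$ satisfying the graded Leibniz rule and the $\cup_1$–$d$ formula $d(a\cup_1 b)=-a\cup b-b\cup a+da\cup_1 b+db\cup_1 a-da\circ db$ for $a,b\in\mathsf{T}^1_R(X)$. The magma $M_\tau$. Let $M=M(X,R)$ be the set of all functions $\mathbf{a}\colon X\to R$; an element $q\in\mathrm{Int}(R^X)$ is evaluated at $\mathbf a$ to give $q(\mathbf a)\in R$. Write $\tau(x)=\sum_i p_{x,i}\otimes q_{x,i}$ with $p_{x,i},q_{x,i}\in\mathfrak{m}_{X,R}$, and define $\mu_\tau\colon M\times M\to M$ by $\mu_\tau(\mathbf a,\mathbf a')(x)=\mathbf a(x)+\mathbf a'(x)-\sum_i p_{x,i}(\mathbf a)q_{x,i}(\mathbf a')$. Then $M_\tau=(M,\mu_\tau)$ is a magma with two-sided unit the zero function. $\tau$ is called admissible if $\mu_\tau$ is associative. $\Delta(M_\tau)$ and its cochains. For a semigroup $M$, $\Delta(M)$ is the $\Delta$-set with one vertex whose $n$-simplices are the $n$-tuples $(a_1,\dots,a_n)\in M^n$, the edge from vertex $i$ to vertex $j$ ($i<j$) being $a_{i+1}\cdots a_j$ (so faces are as in the bar construction). $C^*(\Delta(M);R)$ is its simplicial cochain dga with the usual coboundary $d_\Delta$ (e.g. $(d_\Delta f)(a,a')=f(a)+f(a')-f(aa')$ for 1-cochains) and cup product (front face times back face). For a $\Delta$-set it is a binomial cup-one dga with $(f\cup_1 g)(e)=f(e)g(e)$ on 1-cochains,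 $(v\circ w)(s)=v(s)w(s)$ on 2-cochains, $\cup_1$ of decomposable 2-cochains with 1-cochains given by $(a\cup b)\cup_1 c=a\cup(b\cup_1 c)+(a\cup_1 c)\cup b$, and $\zeta_n(f)(e)=\binom{f(e)}{n}$ on 1-cochains. Binomial cup-one dga. A dga over $R$ is a graded $R$-algebra $A=\bigoplus_{i\ge0}A^i$ (product $\cup$) with a degree-one map $d$, $d^2=0$, satisfying the graded Leibniz rule. $D^2(A)\subset A^2$ is the span of all $a\cup b$, $a,b\in A^1$. A cup-one dga is a dga with $R$-linear maps $\cup_1\colon A^1\otimes_R A^1\to A^1$, $\cup_1\colon D^2(A)\otimes_R A^1\to A^2$, $\circ\colon D^2(A)\otimes_R D^2(A)\to D^2(A)$ such that: (i) $R\oplus A^1$ with $\cup_1$ as multiplication on $A^1$ is a commutative $R$-algebra with identity $1\in R$; (ii) $(a\cup b)\cup_1 c=a\cup(b\cup_1 c)+(a\cup_1 c)\cup b$ for $a,b,c\in A^1$; (iii) $(u\cup v)\circ(w\cup z)=(u\cup_1 w)\cup(v\cup_1 z)$; (iv) $a\cup_1 dc=a\cup c-c\cup a$ for $a\in A^1$, $c\in A^0$; (v) the $\cup_1$–$d$ formula holds for $a,b\in A^1$ with $da,db\in D^2(A)$. It is binomial if $A^0$ (under $\cup$) and $R\oplus A^1$ (under $\cup_1$) are $R$-binomial algebras: for $R=\mathbb Z$, torsion-free commutative rings containing $\zeta_n(a)=\binom{a}{n}$ for all $a$, $n>0$; for $R=\mathbb F_p$, commutative $\mathbb F_p$-algebras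 with $a^p=a$ for all $a$ (then $\zeta_n(a)=a(a-1)\cdots(a-n+1)/n!$ is defined for $1\le n\le p-1$). Morphisms are degree-preserving dga maps commuting with $\cup_1$ on $A^1$ and with the $\zeta_n$ on $A^1$. *)

(* Defs.v *)
From HB Require Import structures.
From mathcomp Require Import all_boot all_order all_algebra.
From mathcomp Require Import finmap.
From mathcomp Require Import boolp classical_sets functions.
From mathcomp.multinomials Require Import monalg.

Set Implicit Arguments.
Unset Strict Implicit.
Unset Printing Implicit Defensive.

Import GRing.Theory Num.Theory.
Local Open Scope ring_scope.
Local Open Scope quotient_scope.

Definition lspan (R : pzRingType) (V : lmodType R) (G : V -> Prop) : {pred V} :=
  fun v => `[< exists s : seq (R * V),
    (forall rg, rg \in s -> G rg.2) /\ v = \sum_(rg <- s) rg.1 *: rg.2 >].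

Lemma lspan_closed (R : pzRingType) (V : lmodType R) (G : V -> Prop) :
  subsemimod_closed (lspan G).
Proof.
split; first split.
- by apply/asboolP; exists [::]; rewrite big_nil.
- move=> u v /asboolP[s [Gs ->]] /asboolP[t [Gt ->]]; apply/asboolP.
  exists (s ++ t); rewrite big_cat; split=> // rg.
  by rewrite mem_cat => /orP[/Gs|/Gt].
move=> r u /asboolP[s [Gs ->]]; apply/asboolP.
exists [seq (r * rg.1, rg.2) | rg <- s]; split.
  by move=> _ /mapP[rg /Gs Grg ->].
by rewrite big_map scaler_sumr; apply: eq_bigr => rg _; rewrite scalerA.
Qed.

Section IntZ.
Variable X : choiceType.

Definition Qpoly := {malg rat[{cmonom X}]}.

HB.instance Definition _ := GRing.ComAlgebra.on Qpoly.

Definition meval (a : X -> rat) (m : {cmonom X}) : rat :=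
  \prod_(x <- finsupp m) a x ^+ m x.

Lemma meval_mmorphism a : mmorphism (meval a).
Proof.
have E (m : {cmonom X}) (D : {fset X}) : (finsupp m `<=` D)%fset ->
    meval a m = \prod_(x <- D) a x ^+ m x.
  move=> sub; rewrite /meval (big_fset_incl _ sub) // => x _.
  by rewrite -cmE_neq0 negbK => /eqP->; rewrite expr0.
split=> [m n|]; last by rewrite /meval mdom1 big_seq_fset0.
pose D := (finsupp m `|` finsupp n)%fset.
rewrite (E _ D) ?mdomD // (E m D) ?fsubsetUl // (E n D) ?fsubsetUr //.
by rewrite -big_split; apply: eq_bigr => x _; rewrite cmM exprD.
Qed.

HB.instance Definition _ a :=
  isMultiplicative.Build {cmonom X} rat (meval a) (meval_mmorphism a).

Definition qeval (a : X -> rat) (q : Qpoly) : rat := mmap idfun (meval a) q.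

HB.instance Definition _ a := GRing.RMorphism.copy (qeval a)
  (mmap (idfun : {rmorphism rat -> rat}) (meval a)).

Definition qvar (x : X) : Qpoly := << ucm x >>.

Definition qbinom (q : Qpoly) (n : nat) : Qpoly :=
  (n`!%:R : rat)^-1 *: \prod_(i < n) (q - i%:R).

Definition intvalued : {pred Qpoly} := fun q =>
  `[< forall a : X -> int, exists z : int, qeval (fun x => (a x)%:~R) q = z%:~R >].

Lemma intvalued_closed : subring_closed intvalued.
Proof.
split=> [|p q /asboolP zp /asboolP zq|p q /asboolP zp /asboolP zq];
    apply/asboolP => a; last 2 first.
- have [[y py] [z qz]] := (zp a, zq a).
  by exists (y - z); rewrite rmorphB /= py qz rmorphB.
- have [[y py] [z qz]] := (zp a, zq a).
  by exists (y * z); rewrite rmorphM /= py qz rmorphM.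
by exists 1; rewrite rmorph1.
Qed.

HB.instance Definition _ :=
  GRing.isSubringClosed.Build Qpoly intvalued intvalued_closed.

Record IntZ := MkIntZ { IntZ_val :> Qpoly; _ : IntZ_val \in intvalued }.

HB.instance Definition _ := [isSub for IntZ_val].
HB.instance Definition _ := [Choice of IntZ by <:].
HB.instance Definition _ := [SubChoice_isSubComNzRing of IntZ by <:].

Definition IntZ_scale (n : int) (q : IntZ) := q *~ n.

Lemma IntZ_scaleA m n q :
  IntZ_scale m (IntZ_scale n q) = IntZ_scale (m * n) q.
Proof. exact: mulrzA_C. Qed.
Lemma IntZ_scale1 : left_id 1 IntZ_scale. Proof. by []. Qed.
Lemma IntZ_scaleDr : right_distributive IntZ_scale +%R.
Proof. by move=> n q r; apply: mulrzDl. Qed.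
Lemma IntZ_scaleDl q : {morph IntZ_scale^~ q : m n / m + n}.
Proof. by move=> m n; apply: mulrzDr. Qed.

HB.instance Definition _ := GRing.Zmodule_isLmodule.Build int IntZ
  IntZ_scaleA IntZ_scale1 IntZ_scaleDr IntZ_scaleDl.

Lemma IntZ_scaleAl (n : int) (q r : IntZ) : n *: (q * r) = n *: q * r.
Proof. by rewrite /GRing.scale /= /IntZ_scale mulrzAl. Qed.

HB.instance Definition _ := GRing.Lmodule_isLalgebra.Build int IntZ IntZ_scaleAl.
HB.instance Definition _ := GRing.Lalgebra_isComAlgebra.Build int IntZ.

Definition IntZ_eval (q : IntZ) (a : X -> int) : int :=
  numq (qeval (fun x => (a x)%:~R) q).

Lemma IntZ_evalE q a : (IntZ_eval q a)%:~R = qeval (fun x => (a x)%:~R) q.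
Proof.
by case: q => q /= qZ; case: (asboolP _ qZ a) => z qz; rewrite /IntZ_eval /= qz numq_int.
Qed.

Lemma qeval_var a x : qeval a (qvar x) = a x.
Proof.
by rewrite /qeval mmapU mul1r /meval mdomU big_seq_fset1 cmUU.
Qed.

Lemma qvar_intvalued x : qvar x \in intvalued.
Proof. by apply/asboolP => a; exists (a x); rewrite qeval_var. Qed.

Definition IntZ_var (x : X) : IntZ := MkIntZ (qvar_intvalued x).

Definition IntZ_zero_const : {pred IntZ} := fun q => mcoeff mone (val q) == 0.

End IntZ.

Section IntF.
Variables (X : choiceType) (p : nat) (p_pr : prime p).

Definition IntF_gen (g : IntZ X) : Prop :=
  (exists x n, (p <= n)%N /\ val g = qbinom (qvar x) n) \/ g = p%:R.

(* The ideal (zeta_n(x), p) for x in X and n >= p: tensoring with F_p is the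
   quotient by p. *)
Definition IntF_ideal of prime p : {pred IntZ X} :=
  lspan (V := (IntZ X)^o) IntF_gen.

Lemma IntF_ideal_closed : idealr_closed (IntF_ideal p_pr).
Proof.
have [[S0 SD] SZ] := lspan_closed (V := (IntZ X)^o) IntF_gen.
split=> //; last by move=> a u v Su Sv; apply: SD => //; apply: SZ.
pose e (q : IntZ X) := qeval (fun=> 0) (IntZ_val q).
have eD u v : e (u + v) = e u + e v by rewrite -rmorphD.
have eM u v : e (u * v) = e u * e v by rewrite -rmorphM.
apply/asboolP => -[s [Gs /(congr1 e)]].
suff [z ->] : exists z : int,
    e (\sum_(rg <- s) rg.1 *: rg.2 : (IntZ X)^o) = p%:R * z%:~R.
  rewrite /e rmorph1 -[p%:R]/((p%:Z)%:~R) -rmorphM -[1]/(1%:~R).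
  move=> /eqP; rewrite eqr_int => /eqP pz.
  have := dvdz_mulr z (dvdzz p); rewrite -pz dvdz1 absz_nat => /eqP p1.
  by have := prime_gt1 p_pr; rewrite p1.
elim: s Gs => [|[r g] s IHs] Gs.
  by exists 0; rewrite big_nil /e !rmorph0 mulr0.
have [|z Ez] := IHs; first by move=> rg srg; apply: Gs; rewrite inE srg orbT.
rewrite big_cons eD Ez.
have [y ->] : exists y : int, e (r * g) = p%:R * y%:~R.
  rewrite eM; have [/= [x [n [le_pn Eg]]]|/= ->] := Gs _ (mem_head _ _); last first.
    exists (IntZ_eval r (fun=> 0)); rewrite IntZ_evalE mulrC.
    by rewrite -[e p%:R]/((qeval (fun=> 0) \o val) p%:R) rmorph_nat.
  exists 0; rewrite mulr0 /e {}Eg /qbinom -mul_malgC rmorphM rmorph_prod /=.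
  case: n le_pn => [|n _]; first by rewrite leqNgt prime_gt0.
  have qx0 : qeval (fun=> 0) (qvar x - (ord0 : 'I_n.+1)%:R) = 0.
    by rewrite subr0 qeval_var.
  by rewrite big_ord_recl qx0 mul0r !mulr0.
by exists (y + z); rewrite rmorphD mulrDr.
Qed.

HB.instance Definition _ :=
  isIdealr.Build (IntZ X) (IntF_ideal p_pr) IntF_ideal_closed.

Definition IntF := {ideal_quot (IntF_ideal p_pr : idealr (IntZ X))}.

HB.instance Definition _ := GRing.ComNzRing.on IntF.

End IntF.
Section IntFAlg.
Variables (X : choiceType) (p : nat) (p_pr : prime p).
Local Notation F := (IntF X p_pr).

Lemma IntF_pchar : (p%:R : F) = 0.
Proof.
rewrite -(rmorph_nat (\pi_F : {rmorphism IntZ X -> F})) /=.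
rewrite -(pi_zeror (s := F)); apply/eqP; rewrite -Quotient.idealrBE subr0.
apply/asboolP; exists [:: (1, p%:R)].
rewrite big_seq1 scale1r; split=> // rg; rewrite inE => /eqP->.
by right.
Qed.

Definition IntF_scale (c : 'F_p) (q : F) : F := q *+ c.

Lemma IntF_natrFp n (q : F) : q *+ (inZp n : 'F_p) = q *+ n.
Proof.
rewrite -[in LHS](mulr_natl q) -[in RHS](mulr_natl q); congr (_ * q).
rewrite [in RHS](divn_eq n p) natrD natrM IntF_pchar mulr0 add0r.
by rewrite /= (Fp_cast p_pr).
Qed.

Lemma IntF_scaleA a b q : IntF_scale a (IntF_scale b q) = IntF_scale (a * b) q.
Proof. by rewrite /IntF_scale IntF_natrFp -mulrnA mulnC. Qed.
Lemma IntF_scale1 : left_id 1 IntF_scale.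
Proof. by move=> q; rewrite /IntF_scale mulr1n. Qed.
Lemma IntF_scaleDr : right_distributive IntF_scale +%R.
Proof. by move=> a q r; rewrite /IntF_scale mulrnDl. Qed.
Lemma IntF_scaleDl q : {morph IntF_scale^~ q : a b / a + b}.
Proof. by move=> a b; rewrite /IntF_scale IntF_natrFp mulrnDr. Qed.

HB.instance Definition _ := GRing.Zmodule_isLmodule.Build 'F_p F
  IntF_scaleA IntF_scale1 IntF_scaleDr IntF_scaleDl.

Lemma IntF_scaleAl (a : 'F_p) (q r : F) : a *: (q * r) = a *: q * r.
Proof. by rewrite /GRing.scale /= /IntF_scale mulrnAl. Qed.

HB.instance Definition _ := GRing.Lmodule_isLalgebra.Build 'F_p F IntF_scaleAl.
HB.instance Definition _ := GRing.Lalgebra_isComAlgebra.Build 'F_p F.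

(* Evaluation at the lift of a with values in {0, .., p-1}: zeta_n vanishes there
   for n >= p, so the result does not depend on the representative. *)
Definition IntF_eval (q : F) (a : X -> 'F_p) : 'F_p :=
  (IntZ_eval (repr q) (fun x => (a x : nat)%:Z))%:~R.

Definition IntF_var (x : X) : F := \pi_F (IntZ_var x).

(* The image of the polynomials in Int(Z^X) with zero constant term. *)
Definition IntF_zero_const : {pred F} :=
  fun q => `[< exists2 r, r \in @IntZ_zero_const X & \pi_F r = q >].

End IntFAlg.

Inductive coef := CoefZ | CoefF (p : nat) of prime p.

Definition coef_ring (k : coef) : comNzRingType :=
  match k with CoefZ => int | CoefF p _ => 'F_p end.

Definition IntR (k : coef) (X : choiceType) : comAlgType (coef_ring k) :=
  match k with CoefZ => IntZ X | CoefF p p_pr => IntF X p_pr end.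

Definition IntR_eval (k : coef) (X : choiceType) : IntR k X -> (X -> coef_ring k) -> coef_ring k :=
  match k with
  | CoefZ => @IntZ_eval X
  | CoefF p p_pr => @IntF_eval X p p_pr
  end.

Definition IntR_var (k : coef) (X : choiceType) : X -> IntR k X :=
  match k with
  | CoefZ => @IntZ_var X
  | CoefF p p_pr => @IntF_var X p p_pr
  end.

Definition zero_const (k : coef) (X : choiceType) : {pred IntR k X} :=
  match k with
  | CoefZ => @IntZ_zero_const X
  | CoefF p p_pr => @IntF_zero_const X p p_pr
  end.

Section AugmentationIdeal.
Variables (k : coef) (X : choiceType).

Lemma IntZ_zero_constD (q r : IntZ X) : q \in @IntZ_zero_const X ->
  r \in @IntZ_zero_const X -> q + r \in @IntZ_zero_const X.
Proof.
by rewrite !unfold_in /= mcoeffD => /eqP-> /eqP->; rewrite addr0.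
Qed.

Lemma IntZ_zero_constM (q r : IntZ X) :
  r \in @IntZ_zero_const X -> q * r \in @IntZ_zero_const X.
Proof.
rewrite !unfold_in /= => /eqP r0.
by rewrite (rmorphM (mcoeff (mone : {cmonom X}))) /= r0 mulr0.
Qed.

Lemma zero_constM (q r : IntR k X) :
  r \in @zero_const k X -> q * r \in @zero_const k X.
Proof.
case: k q r => [|p p_pr] q r; first exact: IntZ_zero_constM.
move=> /asboolP[r' r'0 <-]; apply/asboolP.
exists (repr q * r'); first exact: IntZ_zero_constM.
by rewrite rmorphM /= reprK.
Qed.

Lemma zero_constD (q r : IntR k X) : q \in @zero_const k X ->
  r \in @zero_const k X -> q + r \in @zero_const k X.
Proof.
case: k q r => [|p p_pr] q r; first exact: IntZ_zero_constD.
move=> /asboolP[q' q'0 <-] /asboolP[r' r'0 <-]; apply/asboolP.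
by exists (q' + r'); [exact: IntZ_zero_constD | rewrite rmorphD].
Qed.

Lemma zero_const0 : 0 \in @zero_const k X.
Proof.
have Z0 : 0 \in @IntZ_zero_const X by rewrite unfold_in /= mcoeff0.
case: k => [|p p_pr]; first exact: Z0.
by apply/asboolP; exists 0 => //; rewrite rmorph0.
Qed.

Lemma zero_const_closed : submod_closed (@zero_const k X).
Proof.
split=> [|a q r q0 r0]; first exact: zero_const0.
by apply: zero_constD => //; rewrite -mulr_algl zero_constM.
Qed.

HB.instance Definition _ := GRing.isSubmodClosed.Build
  (coef_ring k) (IntR k X) (@zero_const k X) zero_const_closed.

Lemma IntR_var_zero_const x : IntR_var k x \in @zero_const k X.
Proof.
have Z0 : IntZ_var x \in @IntZ_zero_const X.
  by rewrite unfold_in /= mcoeffU cm1_eq1.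
by case: k => [|p p_pr]; [exact: Z0 | apply/asboolP; exists (IntZ_var x)].
Qed.

Record maug := MkMaug { maug_val :> IntR k X; _ : maug_val \in @zero_const k X }.

HB.instance Definition _ := [isSub for maug_val].
HB.instance Definition _ := [Choice of maug by <:].
HB.instance Definition _ := [SubChoice_isSubLmodule of maug by <:].

Definition maug_mul (q r : maug) : maug :=
  MkMaug (zero_constM (maug_val q) (valP r)).

Definition maug_var (x : X) : maug := MkMaug (IntR_var_zero_const x).

End AugmentationIdeal.

Section LmodQuotient.
Variables (R : pzRingType) (V : lmodType R) (G : V -> Prop).

Lemma lspan_submod_closed : submod_closed (lspan G).
Proof.
have [[S0 SD] SZ] := lspan_closed G.
by split=> // a u v Su Sv; apply: SD => //; apply: SZ.
Qed.

HB.instance Definition _ :=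
  GRing.isSubmodClosed.Build R V (lspan G) lspan_submod_closed.

Definition lquot := Quotient.quot (lspan G : zmodClosed V).

HB.instance Definition _ := GRing.Zmodule.on lquot.

Definition lquot_scale (a : R) (u : lquot) : lquot := \pi_lquot (a *: repr u).

Lemma lquot_scale_pi a v : lquot_scale a (\pi_lquot v) = \pi_lquot (a *: v).
Proof.
apply/eqP; rewrite /lquot_scale -Quotient.idealrBE -scalerBr.
have [_ SZ] := lspan_closed G; apply: SZ.
by rewrite Quotient.idealrBE reprK.
Qed.

Lemma lquotK (u : lquot) : \pi_lquot (repr u) = u.
Proof. exact: reprK. Qed.

Lemma lquot_scaleA a b u : lquot_scale a (lquot_scale b u) = lquot_scale (a * b) u.
Proof. by rewrite -[u]lquotK !lquot_scale_pi scalerA. Qed.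
Lemma lquot_scale1 : left_id 1 lquot_scale.
Proof. by move=> u; rewrite -[u]lquotK lquot_scale_pi scale1r. Qed.
Lemma lquot_scaleDr : right_distributive lquot_scale +%R.
Proof.
move=> a u v; rewrite -[u]lquotK -[v]lquotK.
rewrite -(raddfD (\pi_lquot : {additive V -> lquot})) !lquot_scale_pi.
by rewrite scalerDr raddfD.
Qed.
Lemma lquot_scaleDl u : {morph lquot_scale^~ u : a b / a + b}.
Proof.
by move=> a b; rewrite -[u]lquotK !lquot_scale_pi scalerDl raddfD.
Qed.

HB.instance Definition _ := GRing.Zmodule_isLmodule.Build R lquot
  lquot_scaleA lquot_scale1 lquot_scaleDr lquot_scaleDl.

End LmodQuotient.

Section TensorPower.
Variables (R : comNzRingType) (U : lmodType R).

Definition tset n (t : n.-tuple U) (i : 'I_n) (u : U) : n.-tuple U :=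
  [tuple if j == i then u else tnth t j | j < n].

(* tpow n is the n-th tensor power of U: the free module on U^n modulo the
   multilinearity relations; tens t is the class of u_1 (x) ... (x) u_n. *)
Definition tens_rel n (v : {malg R[n.-tuple U]}) : Prop :=
  exists t i (r : R) u u', v =
    << tset t i (r *: u + u') >> - r *: << tset t i u >> - << tset t i u' >>.

Definition tpow (n : nat) : lmodType R := lquot (@tens_rel n).

Definition tens n (t : n.-tuple U) : tpow n := \pi_(lquot _) << t >>.

(* The linear map induced by a multilinear f, computed on a representative; see
   tlift_spec for the independence of the choice. *)
Definition tlift n (W : lmodType R) (f : n.-tuple U -> W) (u : tpow n) : W :=
  let v : {malg R[n.-tuple U]} := repr u in \sum_(t <- msupp v) v@_t *: f t.

Definition multilinear n (W : lmodType R) (f : n.-tuple U -> W) : Prop :=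
  forall t i, linear (fun u => f (tset t i u)).

Lemma tlift_spec n (W : lmodType R) (f : n.-tuple U -> W) : multilinear f ->
  linear (tlift f) /\ forall t, tlift f (tens t) = f t.
Proof.
move=> f_lin; pose ext (v : {malg R[n.-tuple U]}) := \sum_(t <- msupp v) v@_t *: f t.
have extE v (D : {fset n.-tuple U}) : (msupp v `<=` D)%fset ->
    ext v = \sum_(t <- D) v@_t *: f t.
  by move=> sub; apply: big_fset_incl => // t _ /mcoeff_outdom->; rewrite scale0r.
have ext_lin : linear ext.
  move=> r u v; pose D := (msupp u `|` msupp v `|` msupp (r *: u + v))%fset.
  rewrite !(extE _ D) ?scaler_sumr -?big_split /=.
  - by apply: eq_bigr => t _; rewrite mcoeffD mcoeffZ scalerDl scalerA.
  - by rewrite /D fsubsetU // fsubsetUr.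
  - by rewrite /D fsubsetU // fsubsetUl.
  - by rewrite /D fsubsetUr.
have ext0 : ext 0 = 0 by rewrite /ext msupp0 big_seq_fset0.
have extZ r u : ext (r *: u) = r *: ext u by rewrite -[r *: u]addr0 ext_lin ext0 addr0.
have extD u v : ext (u + v) = ext u + ext v by rewrite -{1}[u]scale1r ext_lin scale1r.
have extN u : ext (- u) = - ext u by rewrite -(scaleN1r u) extZ scaleN1r.
have extU t : ext << t >> = f t.
  by rewrite /ext msuppU oner_eq0 big_seq_fset1 mcoeffUU scale1r.
have ext_rel v : v \in lspan (@tens_rel n) -> ext v = 0.
  move=> /asboolP[s [Gs ->]]; elim: s Gs => [|[r g] s IHs] Gs.
    by rewrite big_nil.
  rewrite big_cons extD extZ IHs; last first.
    by move=> rg srg; apply: Gs; rewrite inE srg orbT.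
  have [t [i [a [u [u' /= ->]]]]] := Gs _ (mem_head _ _).
  by rewrite !extD !extN extZ !extU f_lin addrAC addrK subrr scaler0 addr0.
have ext_pi v : tlift f (\pi_(lquot (@tens_rel n)) v) = ext v.
  apply/eqP; rewrite -subr_eq0 -extN -extD; apply/eqP/ext_rel.
  by rewrite Quotient.idealrBE; apply/eqP/reprK.
split=> [r u v|t]; last by rewrite ext_pi.
rewrite -[u in LHS]lquotK -[v in LHS]lquotK [_ *: _]lquot_scale_pi.
by rewrite -(raddfD (\pi_(lquot (@tens_rel n)) : {additive _ -> _})) ext_pi ext_lin.
Qed.

End TensorPower.

Section CupOne.
Variable R : comNzRingType.

(* cup21 and circ are total functions, but they are only meaningful (and only
   constrained below) on the span decomp = D^2(A) of the products of elements of
   degree 1. *)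
Record cupone_alg := CupOneAlg {
  gr :> nat -> lmodType R;
  gr1 : gr 0;
  cup : forall i j, gr i -> gr j -> gr (i + j);
  cup1 : gr 1 -> gr 1 -> gr 1;
  cup21 : gr 2 -> gr 1 -> gr 2;
  circ : gr 2 -> gr 2 -> gr 2
}.

Definition gcast (A : cupone_alg) m n (e : m = n) (x : A m) : A n :=
  ecast i (A i) e x.

Definition degree1_map (A : cupone_alg) := forall n, A n -> A n.+1.

Variables (A : cupone_alg) (d : degree1_map A).

Definition decomp : {pred A 2} :=
  lspan (fun w : A 2 => exists a b : A 1, w = cup a b).

Definition is_graded_algebra : Prop :=
  [/\ forall i j (b : A j), linear (fun a : A i => cup a b),
      forall i j (a : A i), linear (fun b : A j => cup a b),
      forall i j l (a : A i) (b : A j) (c : A l),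
        gcast (addnA i j l) (cup a (cup b c)) = cup (cup a b) c,
      forall i (a : A i), cup (gr1 A) a = a
    & forall i (a : A i), gcast (addn0 i) (cup a (gr1 A)) = a].

Definition graded_leibniz : Prop := forall i j (a : A i) (b : A j),
  d (cup a b) =
    cup (d a) b + (-1) ^+ i *: gcast (addnS i j) (cup a (d b)).

Definition cup1_d_formula (a b : A 1) : Prop :=
  d (cup1 a b) =
    - cup a b - cup b a + cup21 (d a) b + cup21 (d b) a - circ (d a) (d b).

Definition is_dga : Prop :=
  [/\ is_graded_algebra, forall n, linear (@d n),
      forall n (a : A n), d (d a) = 0 & graded_leibniz].

Definition comm_algebra (V : lmodType R) (e : V) (mul : V -> V -> V) : Prop :=
  [/\ commutative mul, associative mul, left_id e mul
    & forall v, linear (mul v)].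

(* R (+) A^1 with multiplication cup1 on A^1. *)
Definition unitized := (R^o * A 1)%type.
HB.instance Definition _ := GRing.Lmodule.on unitized.
Definition uone : unitized := (1, 0).
Definition umul (x y : unitized) : unitized :=
  (x.1 * y.1, x.1 *: y.2 + y.1 *: x.2 + cup1 x.2 y.2).

Definition cupone_ops_linear : Prop :=
  [/\ forall b : A 1, linear (fun a => cup1 a b),
      forall a : A 1, linear (fun b => cup1 a b),
      forall r v w (b : A 1), v \in decomp -> w \in decomp ->
        cup21 (r *: v + w) b = r *: cup21 v b + cup21 w b
    & forall w, w \in decomp -> linear (fun b => cup21 w b)].

Definition circ_ops_linear : Prop :=
  [/\ forall v w, v \in decomp -> w \in decomp -> circ v w \in decomp,
      forall r u v w, u \in decomp -> v \in decomp -> w \in decomp ->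
        circ (r *: u + v) w = r *: circ u w + circ v w
    & forall r u v w, u \in decomp -> v \in decomp -> w \in decomp ->
        circ w (r *: u + v) = r *: circ w u + circ w v].

Definition cupone_axioms : Prop :=
  [/\ comm_algebra uone umul,
      forall a b c : A 1,
        cup21 (cup a b) c = cup a (cup1 b c) + cup (cup1 a c) b,
      forall u v w z : A 1,
        circ (cup u v) (cup w z) = cup (cup1 u w) (cup1 v z),
      forall (a : A 1) (c : A 0), cup1 a (d c) = cup a c - cup c a
    & forall a b : A 1, d a \in decomp -> d b \in decomp -> cup1_d_formula a b].

Definition is_cupone_dga : Prop :=
  [/\ is_dga, cupone_ops_linear, circ_ops_linear & cupone_axioms].

End CupOne.

Section Binomial.
Variable k : coef.
Local Notation R := (coef_ring k).

Definition falling (V : lmodType R) (e : V) (mul : V -> V -> V) (a : V) (n : nat) : V :=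
  \big[mul/e]_(i < n) (a - e *+ i).

Definition binomial_algebra (V : lmodType R) (e : V) (mul : V -> V -> V) : Prop :=
  comm_algebra e mul /\
  match k with
  | CoefZ =>
      (forall (a : V) n, (0 < n)%N -> a *+ n = 0 -> a = 0) /\
      (forall (a : V) n, (0 < n)%N -> exists z, z *+ n`! = falling e mul a n)
  | CoefF p _ => forall a : V, \big[mul/e]_(i < p) a = a
  end.

Definition zeta_range (n : nat) : bool :=
  (0 < n)%N && match k with CoefZ => true | CoefF p _ => (n < p)%N end.

(* The unique solution z of n! z = a (a - 1) .. (a - n + 1) in a binomial algebra
   (for n in zeta_range). *)
Definition zeta (V : lmodType R) (e : V) (mul : V -> V -> V) (n : nat) (a : V) : V :=
  xget 0 [set z | z *+ n`! = falling e mul a n].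

Definition zeta1 (A : cupone_alg R) (n : nat) (a : A 1) : A 1 :=
  (zeta (uone A) (@umul R A) n (0, a)).2.

Definition is_binomial_cupone_dga (A : cupone_alg R) (d : degree1_map A) : Prop :=
  [/\ is_cupone_dga d,
      binomial_algebra (gr1 A) (fun a b : A 0 => cup a b : A 0)
    & binomial_algebra (uone A) (@umul R A)].

Definition is_morphism (A B : cupone_alg R) (dA : degree1_map A)
    (dB : degree1_map B) (f : forall n, A n -> B n) : Prop :=
  [/\ (forall n, linear (@f n)) /\ f 0 (gr1 A) = gr1 B,
      forall i j (a : A i) (b : A j), f _ (cup a b) = cup (f _ a) (f _ b),
      forall n (a : A n), f _ (dA _ a) = dB _ (f _ a),
      forall a b : A 1, f _ (cup1 a b) = cup1 (f _ a) (f _ b)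
    & forall n (a : A 1), zeta_range n -> f _ (zeta1 n a) = zeta1 n (f _ a)].

End Binomial.

Section BarCochains.
Variables (R : comNzRingType) (M : Type) (op : M -> M -> M).

Definition simplex (n : nat) := 'I_n -> M.

(* The i-th face of (a_1, .., a_{n+1}): a_1 is dropped for i = 0, a_{n+1} for
   i = n + 1, and a_i, a_{i+1} are replaced by their product otherwise. *)
Definition bar_face n (i : 'I_n.+2) (s : simplex n.+1) : simplex n := fun j =>
  let a := s (widen_ord (leqnSn n) j) in
  let a' := s (lift ord0 j) in
  if (j.+1 < i)%N then a else if j.+1 == i :> nat then op a a' else a'.

Definition cochain (n : nat) : lmodType R := simplex n -> R^o.

Definition bar_d n (f : cochain n) : cochain n.+1 := fun s =>
  \sum_(i < n.+2) (-1) ^+ i * f (bar_face i s).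

Definition cochain_cup i j (f : cochain i) (g : cochain j) : cochain (i + j) :=
  fun s => f (fun l => s (lshift j l)) * g (fun l => s (rshift i l)).

Definition cochain_cup1 (f g : cochain 1) : cochain 1 := fun s => f s * g s.

(* On w = a U b this is a U (b U_1 c) + (a U_1 c) U b, and it is linear in w. *)
Definition cochain_cup21 (w : cochain 2) (c : cochain 1) : cochain 2 := fun s =>
  w s * (c (fun=> s ord0) + c (fun=> s ord_max)).

Definition cochain_circ (v w : cochain 2) : cochain 2 := fun s => v s * w s.

Definition bar_cochains : cupone_alg R :=
  @CupOneAlg R cochain (fun=> 1) cochain_cup cochain_cup1 cochain_cup21 cochain_circ.

End BarCochains.

Section TensorAlgebra.
Variables (k : coef) (X : choiceType).
Local Notation R := (coef_ring k).
Local Notation m := (maug k X).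
Local Notation T := (tpow m).

Definition iota1 (q : m) : T 1 := tens [tuple q].
(* The inverse of the isomorphism iota1 : m -> T^1. *)
Definition deg1 (u : T 1) : m := tlift (fun t => thead t) u.

Definition tens2 (q r : m) : T 2 := tens [tuple q; r].
Definition tlift2 (W : lmodType R) (f : m -> m -> W) : T 2 -> W :=
  tlift (fun t => f (tnth t ord0) (tnth t ord_max)).

Definition tcup i j (u : T i) (v : T j) : T (i + j) :=
  tlift (fun s => tlift (fun t => tens (cat_tuple s t)) v) u.

Definition tcup1 (u v : T 1) : T 1 := iota1 (maug_mul (deg1 u) (deg1 v)).

Definition tcup21 (w : T 2) (u : T 1) : T 2 :=
  tlift2 (fun a b => tens2 (maug_mul a (deg1 u)) b + tens2 a (maug_mul b (deg1 u))) w.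

Definition tcirc (v w : T 2) : T 2 :=
  tlift2 (fun a1 a2 =>
    tlift2 (fun b1 b2 => tens2 (maug_mul a1 b1) (maug_mul a2 b2)) w) v.

Definition tensor_alg : cupone_alg R :=
  @CupOneAlg R T (tens [tuple]) tcup tcup1 tcup21 tcirc.

Variable tau : X -> T 2.

Definition is_d_tau (d : degree1_map tensor_alg) : Prop :=
  [/\ forall n, linear (@d n),
      forall x, d _ (iota1 (maug_var k x)) = tau x,
      graded_leibniz d
    & forall a b, cup1_d_formula d a b].

(* Definite description of the d satisfying is_d_tau; the default 0 is never used,
   since such a d exists and is unique. *)
Definition d_tau : degree1_map tensor_alg :=
  if pselect (exists d, is_d_tau d) is left ex then sval (cid ex) else fun _ _ => 0.

Definition mu (a a' : X -> R) : X -> R := fun x =>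
  a x + a' x -
    tlift2 (fun q r => IntR_eval (val q) a * IntR_eval (val r) a' : R^o) (tau x).

Definition admissible : Prop := associative mu.

Definition bar_alg : cupone_alg R := bar_cochains R (X -> R).

Definition d_bar : degree1_map bar_alg := bar_d mu.

Definition extends_eval (psi : forall n, tensor_alg n -> bar_alg n) : Prop :=
  forall (q : m) (s : simplex (X -> R) 1),
    psi 1 (iota1 q) s = IntR_eval (val q) (s ord0).

End TensorAlgebra.

(* Main.v *)
Require Import Defs.
From mathcomp Require Import all_boot all_order all_algebra.
From mathcomp Require Import finmap zify ring.
From mathcomp Require Import boolp classical_sets functions.
From mathcomp.multinomials Require Import monalg.

Set Implicit Arguments.
Unset Strict Implicit.
Unset Printing Implicit Defensive.

Import GRing.Theory Num.Theory.
Local Open Scope ring_scope.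
Local Open Scope quotient_scope.

(** For q in the augmentation ideal m let psi q be the function a |-> q(a), and
    let psi (q_1 (x) .. (x) q_n) (a_1, .., a_n) = q_1(a_1) .. q_n(a_n).  Newton
    interpolation at non-negative integer points, whose basis consists of products
    of binomial coefficients, writes every q of a given finite list as a sum of the
    terms q(a_l) e_l with fixed points a_l and fixed e_l in m.  Applied to each
    tensor factor it shows that psi is injective in all degrees; it also shows that
    the functions sum_i e_i(a) e'_i(a') form a pure subring of the functions on
    M x M.  That subring contains the coordinates of mu_tau, hence all q o mu_tau,
    so the bar coboundary of psi q lies in the image of psi.  By the Leibniz rule
    the image of psi is therefore a subcomplex of the bar cochains; d_tau is the
    coboundary transported along psi, and every identity for it, d_tau^2 = 0
    included, is pulled back from the bar complex. *)

(** * The bar complex *)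

(** The obstacle is that d_tau cannot simply be prescribed on X and extended: m is not free on X
    under the product [cup1]. Over Z the element zeta_n(x) is tied to x by n! zeta_n(x) = x (x - 1)
    .. (x - n + 1), over F_p one has x^p = x, and the consistency of the [cup1]-[d] formula with
    these relations is not visible inside the tensor algebra. Cochains are functions with values in
    a domain, where it is automatic. The same relations explain the word pure. Over Z, zeta_n(x) is
    not a polynomial in x with coefficients in R, only n! zeta_n(x) is, so every induction on
    Int(R^X) needs a class closed under division by nonzero scalars. Interpolation first places the
    coboundary of psi q in the image of Int(R^X) (x) Int(R^X) only; it comes from m (x) m because
    the zero function is a two-sided unit of mu_tau. Associativity enters through the face
    identities behind the vanishing of the squared coboundary. F_p is reached from Z by
    interpolating integral representatives: modulo the ideal, the nodes with a coordinate at least p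
    drop out. *)

Section BarComplex.
Variables (R : comNzRingType) (M : Type) (op : M -> M -> M) (x0 : M).
Hypothesis opA : associative op.

Local Notation C := (cochain R M).

(* Simplices are handled as restrictions of sequences indexed by [nat], which
   removes all ordinal arithmetic from the face identities. *)
Definition restr n (s : nat -> M) : simplex M n := fun i => s i.
Arguments restr n s i : clear implicits.

Lemma restr_surj n (s : simplex M n) : exists s', s = restr n s'.
Proof.
exists (fun l => if insub l is Some i then s i else x0).
by apply: funext => i; rewrite /restr valK.
Qed.

Lemma cochainP n (f g : C n) :
  (forall s, f (restr n s) = g (restr n s)) -> f = g.
Proof. by move=> fg; apply: funext => s; have [s' ->] := restr_surj s. Qed.

Definition seq_face (i : nat) (s : nat -> M) : nat -> M := fun l =>
  if (l.+1 < i)%N then s l else if l.+1 == i then op (s l) (s l.+1) else s l.+1.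

Definition seq_shift (i : nat) (s : nat -> M) : nat -> M := fun l => s (i + l)%N.

Lemma bar_dE n (f : C n) s :
  bar_d op f (restr n.+1 s)
    = \sum_(0 <= i < n.+2) (-1) ^+ i * f (restr n (seq_face i s)).
Proof. by rewrite big_mkord. Qed.

Lemma cochain_cupE i j (f : C i) (g : C j) s :
  cochain_cup f g (restr _ s) = f (restr i s) * g (restr j (seq_shift i s)).
Proof. by []. Qed.

Lemma bar_gcastE m n (e : m = n) (f : C m) s :
  gcast (A := bar_cochains R M) e f (restr n s) = f (restr m s).
Proof. by case: n / e. Qed.

(** The simplicial identity, by cases on the position of l. Associativity is the case i = j, where
    two adjacent products meet in one entry. *)
Lemma seq_face_face i j s : (i <= j)%N ->
  seq_face j (seq_face i s) = seq_face i (seq_face j.+1 s).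
Proof.
move=> le_ij; apply: funext => l; rewrite /seq_face.
repeat (case: ifP => ?); try lia; rewrite ?opA //.
Qed.

(** Passing from n to n + 1 adds the row i = n + 1 and the column j = n; the hypothesis matches
    their terms in pairs of opposite sign. *)
Lemma alternating_double_sum n (G : nat -> nat -> R) :
    (forall i j, (i <= j)%N -> G i j = G j.+1 i) ->
  \sum_(0 <= i < n.+1) (-1) ^+ i * (\sum_(0 <= j < n) (-1) ^+ j * G i j) = 0.
Proof.
move=> GE; elim: n => [|n IHn]; first by rewrite big_nat1 big_geq ?mulr0.
rewrite big_nat_recr //=.
under eq_bigr => i _ do rewrite big_nat_recr //= mulrDr.
rewrite big_split /= IHn add0r mulr_sumr -big_split big_nat big1 //= => i lt_in.
by rewrite GE // exprS; ring.
Qed.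

Lemma bar_dd n (f : C n) : bar_d op (bar_d op f) = 0.
Proof.
apply: cochainP => s; rewrite bar_dE.
under eq_bigr => i _ do rewrite bar_dE.
apply: (@alternating_double_sum n.+2
  (fun i j => f (restr n (seq_face j (seq_face i s))))).
by move=> i j le_ij; rewrite seq_face_face.
Qed.

Lemma bar_linear n : linear (@bar_d R M op n).
Proof.
move=> r f g; apply: funext => s; rewrite /bar_d -[RHS]/(r * _ + _) mulr_sumr -big_split.
by apply: eq_bigr => i _; rewrite -[_ (bar_face _ _ _)]/(r * f _ + g _) /=; ring.
Qed.

Lemma bar_leibniz : graded_leibniz (A := bar_cochains R M) (@bar_d R M op).
Proof.
move=> i j f g; apply: cochainP => s.
rewrite -[RHS]/(cochain_cup (bar_d op f) g (restr (i.+1 + j) s) + (-1) ^+ i *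
  gcast (A := bar_cochains R M) (addnS i j) (cochain_cup f (bar_d op g)) (restr _ s)).
rewrite bar_gcastE !cochain_cupE !bar_dE.
(* Faces 0, .., i act on the front block, the others on the back block. On the right, the last face
   of the front block and face 0 of the back block give the same product with opposite signs; they
   are split off so that they cancel. *)
rewrite (@big_cat_nat _ _ _ i.+1) //=; last by lia.
rewrite [in RHS]big_nat_recr // [X in _ + _ * (_ * X)]big_nat_recl //=.
have -> : restr i (seq_face i.+1 s) = restr i s.
  by apply: funext => l; rewrite /restr /seq_face ltnS ltn_ord.
have -> : restr j (seq_face 0 (seq_shift i s)) = restr j (seq_shift i.+1 s).
  by apply: funext => l; rewrite /restr /seq_face /seq_shift /= addSnnS.
rewrite [X in _ + X = _](_ : _ = \sum_(0 <= l < j.+1) (-1) ^+ i * (f (restr i s) *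
    ((-1) ^+ l.+1 * g (restr j (seq_face l.+1 (seq_shift i s)))))); last first.
  rewrite [in RHS]big_mkord.
  rewrite -{1}[i.+1]add0n (_ : (i + j).+2 = (j.+1 + i.+1)%N); last by lia.
  rewrite big_addn addnK big_mkord; apply: eq_bigr => l _.
  rewrite [X in _ * X](cochain_cupE f g).
  have -> : restr i (seq_face (l + i.+1) s) = restr i s.
    by apply: funext => q; rewrite /restr /seq_face; case: ifP => //; have := ltn_ord q; lia.
  have -> : restr j (seq_shift i (seq_face (l + i.+1) s))
      = restr j (seq_face l.+1 (seq_shift i s)).
    apply: funext => q; rewrite /restr /seq_face /seq_shift /=.
    have -> : ((i + q).+1 < l + i.+1)%N = (q.+1 < l.+1)%N by lia.
    have -> : ((i + q).+1 == l + i.+1)%N = (q.+1 == l.+1)%N by lia.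
    by rewrite addnS.
  have -> : (l + i.+1)%N = (i + l.+1)%N by lia.
  rewrite exprD; ring.
rewrite [X in X + _ = _](_ : _ = \sum_(0 <= l < i.+1) ((-1) ^+ l *
    f (restr i (seq_face l s))) * g (restr j (seq_shift i.+1 s))); last first.
  apply: congr_big_nat => // l /andP[_ lt_li].
  rewrite [X in _ * X](cochain_cupE f g) mulrA; congr (_ * g _).
  apply: funext => q; rewrite /restr /seq_face /seq_shift /=.
  by rewrite ifF ?ifF ?addSn //; lia.
rewrite -mulr_suml -mulr_sumr -mulr_sumr exprS; ring.
Qed.

End BarComplex.
Arguments restr {M} n s i.

(** * The cup-one structure on bar cochains *)

Section BarAlgebra.
Variables (R : comNzRingType) (M : Type) (op : M -> M -> M) (x0 : M).
Hypothesis opA : associative op.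

Local Notation C := (cochain R M).
Local Notation A := (bar_cochains R M).
Local Notation d := (@bar_d R M op : degree1_map A).

Lemma restr1E (s : nat -> M) : restr 1 s = fun=> s 0.
Proof. by apply: funext => i; rewrite /restr ord1. Qed.

Lemma cochain_cup11E (f g : C 1) (s : simplex M 2) :
  cochain_cup f g s = f (fun=> s ord0) * g (fun=> s ord_max).
Proof.
rewrite /cochain_cup; congr (f _ * g _); apply: funext => i; rewrite ord1;
  by congr s; apply: val_inj.
Qed.

Lemma bar_d1E (f : C 1) (s : simplex M 2) :
  bar_d op f s = f (fun=> s ord_max) - f (fun=> op (s ord0) (s ord_max))
                 + f (fun=> s ord0).
Proof.
have [s' ->] := restr_surj x0 s; rewrite bar_dE.
rewrite !big_nat_recr //= big_geq // add0r !restr1E /seq_face /=.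
by rewrite expr0 expr1 sqrrN expr1n !mul1r mulN1r.
Qed.

(** Both ends of an edge are the unique vertex. Axiom (iv) thereby reduces to commutativity of R. *)
Lemma bar_d0E (f : C 0) : bar_d op f = 0.
Proof.
apply: funext => s; have [s' ->] := restr_surj x0 s; rewrite bar_dE.
rewrite !big_nat_recr //= big_geq // add0r expr0 expr1 mulN1r mul1r.
have -> : restr 0 (seq_face op 1 s') = restr 0 (seq_face op 0 s').
  by apply: funext => -[].
exact: subrr.
Qed.

Lemma bar_graded_algebra : is_graded_algebra A.
Proof.
split.
- move=> i j g r f f'; apply: funext => s.
  rewrite -[RHS]/(r * (_ * _) + _ * _) -[LHS]/((r * _ + _) * _); ring.
- move=> i j f r g g'; apply: funext => s.
  rewrite -[RHS]/(r * (_ * _) + _ * _) -[LHS]/(_ * (r * _ + _)); ring.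
- move=> i j l f g h; apply: (cochainP x0) => s; rewrite bar_gcastE.
  rewrite /= !cochain_cupE mulrA; congr (_ * h _).
  by apply: funext => q; rewrite /restr /seq_shift addnA.
- by move=> i f; apply: (cochainP x0) => s; rewrite /= cochain_cupE mul1r.
- by move=> i f; apply: (cochainP x0) => s; rewrite bar_gcastE /= cochain_cupE mulr1.
Qed.

Lemma bar_is_dga : is_dga d.
Proof.
split; first exact: bar_graded_algebra.
- by move=> n; apply: bar_linear.
- by move=> n f; apply: (bar_dd x0).
- exact: (@bar_leibniz _ _ op x0).
Qed.

(** A polynomial identity in the six values of f and g on the three edges of a 2-simplex. *)
Lemma bar_cup1_d (f g : A 1) : cup1_d_formula d f g.
Proof.
apply: funext => s.
rewrite -[RHS]/(- cochain_cup f g s - cochain_cup g f s + bar_d op f s *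
  (g (fun=> s ord0) + g (fun=> s ord_max)) + bar_d op g s *
  (f (fun=> s ord0) + f (fun=> s ord_max)) - bar_d op f s * bar_d op g s).
rewrite !bar_d1E !cochain_cup11E /cup1 /= /cochain_cup1; ring.
Qed.

Lemma bar_circ_decomp (v w : A 2) :
  v \in @decomp R A -> w \in @decomp R A -> circ v w \in @decomp R A.
Proof.
have [[S0 SD] SZ] := lspan_closed (fun w : A 2 => exists a b : A 1, w = cup a b).
have circDl r a b c : circ (r *: a + b) c = r *: circ a c + circ b c :> A 2.
  apply: funext => s; rewrite -[RHS]/(r * (_ * _) + _ * _).
  rewrite -[LHS]/((r * _ + _) * _); ring.
have circC a b : circ a b = circ b a :> A 2.
  by apply: funext => s; rewrite -[LHS]/(_ * _) mulrC.
have circ0 a : circ 0 a = 0 :> A 2.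
  by apply: funext => s; rewrite -[LHS]/(0 * _) mul0r.
move=> /asboolP[sv [Gv ->]] /asboolP[sw [Gw ->]].
elim: sv Gv => [|[r a] sv IHv] Gv; first by rewrite big_nil circ0.
rewrite big_cons circDl; apply: (SD); last first.
  by apply: IHv => rg rgs; apply: Gv; rewrite inE rgs orbT.
apply: (SZ); have {IHv} [f [f' ->]] := Gv _ (mem_head _ _).
elim: sw Gw => [|[r' b] sw IHw] Gw; first by rewrite big_nil circC circ0.
rewrite big_cons circC circDl; apply: (SD); last first.
  by rewrite circC; apply: IHw => rg rgs; apply: Gw; rewrite inE rgs orbT.
apply: (SZ); have [g [g' ->]] := Gw _ (mem_head _ _).
apply/asboolP; exists [:: (1, cup (cup1 f g : A 1) (cup1 f' g' : A 1))]; split.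
  by move=> rg; rewrite inE => /eqP->; exists (cup1 f g), (cup1 f' g').
rewrite big_seq1 scale1r; apply: funext => s.
rewrite -[LHS]/(_ * _ * (_ * _)) -[RHS]/(_ * _ * (_ * _)); ring.
Qed.

Lemma bar_unitized_comm : comm_algebra (uone A) (@umul R A).
Proof.
have cup1E (f g : C 1) s : cochain_cup1 f g s = f s * g s by [].
split.
- move=> [a f] [b g]; congr pair; first exact: mulrC.
  by apply: funext => s; rewrite -[LHS]/(_ * _ + _ * _ + _ * _)
    -[RHS]/(_ * _ + _ * _ + _ * _) /=; ring.
- move=> [a f] [b g] [c h]; congr pair; first exact: mulrA.
  apply: funext => s /=.
  rewrite -[LHS]/(a * (b * h s + c * g s + g s * h s) + (b * c) * f s
     + f s * (b * h s + c * g s + g s * h s)).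
  rewrite -[RHS]/((a * b) * h s + c * (a * g s + b * f s + f s * g s)
     + (a * g s + b * f s + f s * g s) * h s); ring.
- move=> [a f]; congr pair; first exact: mul1r.
  apply: funext => s /=; rewrite -[LHS]/(1 * f s + a * 0 + 0 * f s); ring.
- move=> [a f] r [b g] [c h]; congr pair.
    by rewrite -[LHS]/(a * (r * b + c)) -[RHS]/(r * (a * b) + a * c); ring.
  apply: funext => s /=.
  rewrite -[LHS]/(a * (r * g s + h s) + (r * b + c) * f s + f s * (r * g s + h s)).
  rewrite -[RHS]/(r * (a * g s + b * f s + f s * g s) + (a * h s + c * f s + f s * h s)).
  ring.
Qed.

Lemma bar_is_cupone_dga : is_cupone_dga d.
Proof.
split; first exact: bar_is_dga.
- split.
  + move=> g r f f'; apply: funext => s.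
    by rewrite -[RHS]/(r * (_ * _) + _ * _) -[LHS]/((r * _ + _) * _); ring.
  + move=> f r g g'; apply: funext => s.
    by rewrite -[RHS]/(r * (_ * _) + _ * _) -[LHS]/(_ * (r * _ + _)); ring.
  + move=> r v w f _ _; apply: funext => s.
    by rewrite -[RHS]/(r * (_ * _) + _ * _) -[LHS]/((r * _ + _) * _); ring.
  + move=> w _ r f g; apply: funext => s.
    rewrite -[RHS]/(r * (w s * (f _ + f _)) + w s * (g _ + g _)).
    by rewrite -[LHS]/(w s * ((r * _ + _) + (r * _ + _))); ring.
- split; first exact: bar_circ_decomp.
  + move=> r u v w _ _ _; apply: funext => s.
    by rewrite -[RHS]/(r * (_ * _) + _ * _) -[LHS]/((r * _ + _) * _); ring.
  + move=> r u v w _ _ _; apply: funext => s.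
    by rewrite -[RHS]/(r * (_ * _) + _ * _) -[LHS]/(_ * (r * _ + _)); ring.
split; first exact: bar_unitized_comm.
- move=> f g h; apply: funext => s.
  rewrite -[RHS]/(cochain_cup f (cochain_cup1 g h) s + cochain_cup (cochain_cup1 f h) g s).
  rewrite -[LHS]/(cochain_cup f g s * (h _ + h _)) !cochain_cup11E /cochain_cup1; ring.
- move=> u v w z; apply: funext => s.
  by rewrite -[LHS]/(_ * _ * (_ * _)) -[RHS]/(_ * _ * (_ * _)); ring.
- move=> f c; rewrite [d _ _]bar_d0E; apply: funext => s.
  rewrite -[RHS]/(f _ * c _ - c _ * f _) -[LHS]/(f s * 0) mulr0.
  rewrite [c _ * _]mulrC; apply/eqP; rewrite eq_sym subr_eq0; apply/eqP.
  congr (f _ * c _); apply: funext => i; last by case: i.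
  by congr s; apply: val_inj.
- by move=> f g _ _; apply: bar_cup1_d.
Qed.

End BarAlgebra.

(** * Binomial algebras and characters *)

Lemma prod_natr_sub (A : comNzRingType) j k :
  \prod_(i < k) (j%:R - i%:R) = (j ^_ k)%:R :> A.
Proof.
elim: k => [|k IHk]; first by rewrite big_ord0.
rewrite big_ord_recr IHk ffactnSr natrM /=.
have [le_kj|lt_jk] := leqP k j; first by rewrite natrB.
by rewrite ffact_small ?mul0r.
Qed.

Lemma int_binomial (z : int) n : exists w : int, w *+ n`! = \prod_(i < n) (z - i%:R).
Proof.
case: z => m.
  exists ('C(m, n))%:Z; rewrite -mulr_natr natz -PoszM bin_ffact -natz -prod_natr_sub.
  by apply: eq_bigr => i _; rewrite !natz.
(* Upper negation: the binomial coefficient of -(m + 1) over n is (-1)^n C(m + n, n). *)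
exists ((-1) ^+ n * ('C(m + n, n))%:Z).
rewrite -mulr_natr natz -mulrA -PoszM bin_ffact.
elim: n => [|n IHn]; first by rewrite big_ord0 addn0.
rewrite big_ord_recr -IHn addnS ffactSS /= PoszM NegzE exprS natz.
by rewrite (_ : (m + n).+1 = (m.+1 + n)%N) // PoszD; ring.
Qed.

Lemma prime_dvd_fact p n : prime p -> (p %| n`!)%N -> (p <= n)%N.
Proof.
move=> p_pr; elim: n => [|n IHn]; first by rewrite dvdn1 => /eqP p1; rewrite p1 in p_pr.
rewrite factS Euclid_dvdM // => /orP[/dvdn_leq-> //|/IHn]; exact: leqW.
Qed.

Lemma coef_mulI k (c x y : coef_ring k) : c != 0 -> c * x = c * y -> x = y.
Proof.
case: k c x y => [|p p_pr] c x y c0; first exact: (@mulfI int).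
exact: (@mulfI 'F_p).
Qed.

Lemma fact_coef_neq0 k n : zeta_range k n -> n`!%:R != 0 :> coef_ring k.
Proof.
rewrite /zeta_range; case: k => [|p p_pr] /andP[_ n_p].
  by rewrite -[_%:R]/(n`!%:R : int) natz -lt0n fact_gt0.
rewrite -[_%:R]/(n`!%:R : 'F_p) -(dvdn_pcharf (pchar_Fp p_pr)).
by apply/negP => /(prime_dvd_fact p_pr); rewrite leqNgt n_p.
Qed.

Lemma coef_binomial k n (r : coef_ring k) :
  zeta_range k n -> exists w, w *+ n`! = \prod_(i < n) (r - i%:R).
Proof.
move=> /[dup] n_k /fact_coef_neq0; case: k r n_k => [|p p_pr] r _ n0.
  exact: int_binomial.
exists ((n`!%:R : 'F_p)^-1 * \prod_(i < n) (r - i%:R)).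
by rewrite -mulr_natl mulrA [X in X * _](mulfV (F := 'F_p) n0) mul1r.
Qed.

Lemma coef_expp p (p_pr : prime p) (r : coef_ring (CoefF p_pr)) : r ^+ p = r.
Proof.
have := pFrobenius_aut_nat (pchar_Fp p_pr) r.
by rewrite pFrobenius_autE natr_Zp.
Qed.

Section Characters.
Variables (k : coef) (V : lmodType (coef_ring k)) (e : V) (mul : V -> V -> V).
Variables (I : Type) (chi : I -> V -> coef_ring k).
Hypothesis chiP : forall i c u v, chi i (c *: u + v) = c * chi i u + chi i v.
Hypothesis chiM : forall i u v, chi i (mul u v) = chi i u * chi i v.
Hypothesis chi1 : forall i, chi i e = 1.
Hypothesis chi_inj : forall u v, (forall i, chi i u = chi i v) -> u = v.

Lemma comm_algebra_chi : comm_algebra e mul.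
Proof.
split.
- by move=> u v; apply: chi_inj => i; rewrite !chiM mulrC.
- by move=> u v w; apply: chi_inj => i; rewrite !chiM mulrA.
- by move=> u; apply: chi_inj => i; rewrite chiM chi1 mul1r.
- by move=> w c u v; apply: chi_inj => i; rewrite chiM !chiP !chiM; ring.
Qed.

Lemma chi0 i : chi i 0 = 0.
Proof. by have := chiP i (-1) 0 0; rewrite scaler0 addr0 mulN1r addNr. Qed.

Lemma chiD i u v : chi i (u + v) = chi i u + chi i v.
Proof. by rewrite -[u in LHS]scale1r chiP mul1r. Qed.

Lemma chiB i u v : chi i (u - v) = chi i u - chi i v.
Proof. by rewrite addrC -scaleN1r chiP mulN1r addrC. Qed.

Lemma chiMn i u n : chi i (u *+ n) = chi i u *+ n.
Proof. by elim: n => [|n IHn]; rewrite ?mulr0n ?chi0 // !mulrS chiD IHn. Qed.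

Lemma chi_falling i a n : chi i (falling e mul a n) = \prod_(j < n) (chi i a - j%:R).
Proof.
rewrite /falling (big_morph (chi i) (chiM i) (chi1 i)).
by apply: eq_bigr => j _; rewrite chiB chiMn chi1.
Qed.

Lemma chi_fact_inj n (u v : V) : zeta_range k n -> u *+ n`! = v *+ n`! -> u = v.
Proof.
move=> /fact_coef_neq0 n0 uv; apply: chi_inj => i; apply: (coef_mulI n0).
by rewrite !mulr_natl -!chiMn uv.
Qed.

Hypothesis chi_binomial : forall a n, zeta_range k n ->
  exists z, forall i, chi i z *+ n`! = \prod_(j < n) (chi i a - j%:R).

Lemma falling_divisible a n : zeta_range k n -> exists z, z *+ n`! = falling e mul a n.
Proof.
move=> n_k; have [z zE] := chi_binomial a n_k; exists z.
by apply: chi_inj => i; rewrite chiMn zE chi_falling.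
Qed.

(** The characters embed V in the functions from I to R, and R is itself binomial. Identities and
    torsion-freeness are inherited by any such V; existence of zeta_n is not, so [chi_binomial] asks
    that the pointwise binomials come from V. *)
Lemma binomial_algebra_chi : binomial_algebra e mul.
Proof.
split; first exact: comm_algebra_chi.
(* The module and its characters are generalized because their types depend on k. *)
have chi_div := falling_divisible; have chiX := chiMn; move: V e mul chi chi_inj chiM chi1 chi_div chiX.
case: k => [|p p_pr] V' e' mul' ch ch_inj chM ch1 ch_div chX.
  split=> [a n n_gt0 an0|a n n_gt0]; last by apply: ch_div; rewrite /zeta_range n_gt0.
  apply: ch_inj => i; have := congr1 (ch i) an0; rewrite chX.
  have -> : ch i 0 = 0 by rewrite -(mulr0n a) chX mulr0n.
  move=> /eqP; rewrite (Num.Theory.mulrn_eq0 (ch i a : int)) => /orP[|/eqP //].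
  by rewrite eqn0Ngt n_gt0.
move=> a; apply: ch_inj => i.
by rewrite (big_morph (ch i) (chM i) (ch1 i)) prodr_const card_ord coef_expp.
Qed.

End Characters.

(* The solution of n! z = a (a - 1) .. (a - n + 1) is unique in W, so any solution
   that comes from V is the image of the one selected by zeta. *)
Lemma zeta_morphism k (V W : lmodType (coef_ring k)) e mul e' mul' (f : V -> W) n a :
    (forall u v, f (u + v) = f u + f v) -> (forall u v, f (mul u v) = mul' (f u) (f v)) ->
    f e = e' -> (exists z, z *+ n`! = falling e mul a n) ->
    (forall u v : W, u *+ n`! = v *+ n`! -> u = v) ->
  f (zeta e mul n a) = zeta e' mul' n (f a).
Proof.
move=> fD fM f1 [z zE] W_inj.
have f0 : f 0 = 0 by apply: (addrI (f 0)); rewrite -fD !addr0.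
have fMn u j : f (u *+ j) = f u *+ j.
  by elim: j => [|j IHj]; rewrite ?mulr0n // !mulrS fD IHj.
have fN u : f (- u) = - f u by apply/eqP; rewrite -addr_eq0 -fD addNr f0.
have f_fall : f (falling e mul a n) = falling e' mul' (f a) n.
  rewrite /falling (big_morph f fM f1); apply: eq_bigr => i _.
  by rewrite fD fN fMn f1.
have solV : zeta e mul n a *+ n`! = falling e mul a n 
  by apply: (@xgetPex _ 0 [set z | z *+ n`! = falling e mul a n]%classic); exists z.
have solW : zeta e' mul' n (f a) *+ n`! = falling e' mul' (f a) n.
  apply: (@xgetPex _ 0 [set z | z *+ n`! = falling e' mul' (f a) n]%classic).
  by exists (f z); rewrite /= -fMn zE.
by apply: W_inj; rewrite solW -fMn solV.
Qed.

(** * Interpolation by integer-valued polynomials *)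

Section UnivariateInterpolation.

Definition bin_poly (k : nat) : {poly rat} :=
  (k`!%:R)^-1 *: \prod_(i < k) ('X - i%:R%:P).

Definition newton_coef (k b : nat) : int := (('X - 1) ^+ k : {poly int})`_b.

(* The Lagrange polynomial of the node b among 0, .., N - 1, in the Newton basis:
   expanding 'X^j = (1 + ('X - 1))^j shows that the coefficients of the powers of
   'X - 1 form the inverse of the Pascal matrix. *)
Definition lagrange_poly (N b : nat) : {poly rat} :=
  \sum_(k < N) (newton_coef k b)%:~R *: bin_poly k.

Lemma newton_coef_gt k b : (k < b)%N -> newton_coef k b = 0.
Proof.
by move=> lt_kb; rewrite /newton_coef nth_default // size_exp_XsubC.
Qed.

Lemma bin_poly_nat k j : (bin_poly k).[j%:R] = ('C(j, k))%:R.
Proof.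
rewrite /bin_poly hornerZ horner_prod.
under eq_bigr => i _ do rewrite !hornerE.
rewrite prod_natr_sub -bin_ffact natrM mulrC mulfK //.
by rewrite pnatr_eq0 -lt0n fact_gt0.
Qed.

Lemma size_bin_poly k : (size (bin_poly k) <= k.+1)%N.
Proof.
apply: leq_trans (size_scale_leq _ _) _.
by rewrite size_prod_XsubC /index_enum -enumT size_enum_ord.
Qed.

Lemma size_lagrange_poly N b : (size (lagrange_poly N b) <= N)%N.
Proof.
apply: leq_trans (size_sum _ _ _) _; apply/bigmax_leqP => k _.
apply: leq_trans (size_scale_leq _ _) _.
exact: leq_trans (size_bin_poly _) (ltn_ord k).
Qed.

Lemma lagrange_poly_nat N b j : (j < N)%N -> (lagrange_poly N b).[j%:R] = (b == j)%:R.
Proof.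
move=> lt_jN; rewrite /lagrange_poly horner_sum.
transitivity ((\sum_(k < j.+1) newton_coef k b * 'C(j, k)%:R)%:~R : rat).
  rewrite rmorph_sum (big_ord_widen N (fun k => (newton_coef k b * 'C(j, k)%:R)%:~R)) //.
  rewrite [RHS]big_mkcond; apply: eq_bigr => k _.
  rewrite hornerZ bin_poly_nat rmorphM /= rmorph_nat.
  by case: ltnP => // lt_jk; rewrite bin_small // mulr0.
have := exprDn (1 : {poly int}) ('X - 1) j; rewrite addrCA subrr addr0.
move=> /(congr1 (coefp b)); rewrite /= coefXn coef_sum => E.
rewrite -[RHS](rmorph_nat (intr : int -> rat)) [in RHS]natz; congr (_%:~R).
rewrite -natz E; apply: eq_bigr => k _.
by rewrite expr1n mul1r coefMn mulr_natr.
Qed.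

(** Both sides have degree less than N and agree at the N points 0, .., N - 1. *)
Lemma expX_lagrange N m : (m < N)%N ->
  'X^m = \sum_(b < N) (b%:R ^+ m) *: lagrange_poly N b.
Proof.
move=> lt_mN; apply/eqP; rewrite -subr_eq0; apply/eqP.
apply: (@roots_geq_poly_eq0 _ _ [seq j%:R | j <- iota 0 N]).
- apply/allP => y /mapP[j]; rewrite mem_iota add0n => /andP[_ lt_jN] ->.
  rewrite /root !hornerE.
  rewrite horner_sum (bigD1 (Ordinal lt_jN)) //= big1 => [|b ne_bj]; rewrite hornerZ.
    by rewrite lagrange_poly_nat // eqxx mulr1 addr0 subrr.
  rewrite lagrange_poly_nat // (_ : _ == _ = false) ?mulr0 //.
  by apply: contraNF ne_bj => /eqP bj; apply/eqP/val_inj.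
- by rewrite map_inj_uniq ?iota_uniq // => i j /eqP; rewrite eqr_nat => /eqP.
rewrite size_map size_iota (leq_trans (size_polyD _ _)) // geq_max size_polyXn lt_mN.
rewrite size_polyN; apply: leq_trans (size_sum _ _ _) _; apply/bigmax_leqP => b _.
exact: leq_trans (size_scale_leq _ _) (size_lagrange_poly _ _).
Qed.

End UnivariateInterpolation.

Section InterpolationZ.
Variable X : choiceType.

Lemma qbinom_var_intvalued (x : X) n : qbinom (qvar x) n \in @intvalued X.
Proof.
apply/asboolP => a; have [w wE] := int_binomial (a x) n; exists w.
rewrite /qbinom -mul_malgC rmorphM rmorph_prod /=.
rewrite [X in X * _]mmapC /=.
under eq_bigr => i _ do rewrite rmorphB rmorph_nat /= qeval_var.
apply: (@mulfI _ n`!%:R); first by rewrite pnatr_eq0 -lt0n fact_gt0.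
rewrite mulrA mulfV ?mul1r; last by rewrite pnatr_eq0 -lt0n fact_gt0.
rewrite mulr_natl -rmorphMn /= wE rmorph_prod; apply: eq_bigr => i _.
by rewrite rmorphB rmorph_nat.
Qed.

Definition zetaZ (x : X) (n : nat) : IntZ X := MkIntZ (qbinom_var_intvalued x n).

Lemma IntZ_valZ (n : int) (q : IntZ X) : IntZ_val (n *: q) = n%:~R *: IntZ_val q.
Proof. by rewrite scaler_int -(rmorphMz (val : {rmorphism IntZ X -> Qpoly X})). Qed.

(** A Lagrange polynomial has rational coefficients in powers of x, but integral ones in the Newton
    basis; this puts it in Int(Z^X). *)
Definition lagrangeZ N (x : X) b : IntZ X := \sum_(k < N) newton_coef k b *: zetaZ x k.

Lemma lagrangeZ_horner N x b :
  val (lagrangeZ N x b) = horner_alg (qvar x) (lagrange_poly N b).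
Proof.
rewrite /lagrangeZ /lagrange_poly !rmorph_sum /=; apply: eq_bigr => k _.
rewrite linearZ IntZ_valZ /= mulr_algl; congr (_ *: _).
rewrite /bin_poly linearZ /= mulr_algl rmorph_prod /qbinom; congr (_ *: _).
by apply: eq_bigr => i _; rewrite rmorphB /= horner_algX polyCMn rmorph_nat.
Qed.

Lemma malg_prod_var (m : {cmonom X}) (D : {fset X}) : (finsupp m `<=` D)%fset ->
  << m >> = \prod_(x <- D) qvar x ^+ m x :> Qpoly X.
Proof.
move=> mD.
have phiM (m1 m2 : {cmonom X}) : << mmul m1 m2 >> = << m1 >> * << m2 >> :> Qpoly X.
  by rewrite [RHS]fgmulUU mulr1.
pose pw x := iter (m x) (mmul (ucm x : {cmonom X})) mone.
have pwE x : << pw x >> = qvar x ^+ m x :> Qpoly X.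
  rewrite /pw; elim: (m x) => [|n IHn]; first by rewrite expr0.
  by rewrite iterS phiM IHn exprS.
transitivity (<< \big[mmul/mone]_(x <- D) pw x >> : Qpoly X); last first.
  rewrite (big_morph (fun m : {cmonom X} => << m >> : Qpoly X) phiM (erefl _)).
  by apply: eq_bigr => x _.
congr (<< _ >>); apply/eqP/cmP => y.
rewrite (big_morph (fun m : {cmonom X} => m y : nat) (cmM y) (cm1 y)).
have pwy x : (pw x) y = (m x * (x == y))%N.
  rewrite /pw; elim: (m x) => [|n IHn]; first by rewrite cm1.
  by rewrite iterS cmM IHn cmU mulSn.
under eq_bigr => x _ do rewrite pwy.
have [yD|yD] := boolP (y \in D).
  rewrite (big_fsetD1 y) //= eqxx muln1 big1_seq ?addn0 // => x /andP[_].
  by rewrite !inE => /andP[/negPf-> _]; rewrite muln0.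
rewrite big1_seq => [|x /andP[_ xD]]; last first.
  by case: eqP => [xy|_]; rewrite ?muln0 //; rewrite -xy xD in yD.
by apply/eqP; rewrite cmE_eq0; apply: contra yD; apply: (fsubsetP mD).
Qed.

Lemma malgUZ c (m : {cmonom X}) : << c *g m >> = c *: << m >> :> Qpoly X.
Proof. by rewrite -mul_malgC [RHS]fgmulUU mulr1 mul1m. Qed.

Section Nodes.
Variables (D : {fset X}) (N : nat).
Implicit Type b : {ffun D -> 'I_N}.

(** The default 0 outside D is harmless: the polynomials interpolated at these nodes involve only
    variables in D. *)
Definition node b (x : X) : nat := if insub x is Some x' then b x' else 0.

Lemma node_val b (x : D) : node b (val x) = b x.
Proof. by rewrite /node valK. Qed.

Definition lagrange_prod b : IntZ X := \prod_(x : D) lagrangeZ N (val x) (b x).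

(** Each power of a variable is interpolated separately; distributing the product of these sums
    gives one term per node of the grid. *)
Lemma malg_interp (m : {cmonom X}) : (finsupp m `<=` D)%fset -> (forall x, m x < N)%N ->
  << m >> = \sum_b meval (fun x => (node b x)%:R) m *: val (lagrange_prod b) :> Qpoly X.
Proof.
move=> mD mN; rewrite (malg_prod_var mD) big_seq_fsetE /=.
under eq_bigr => x _.
  rewrite -{1}[qvar _](horner_algX (R := rat)) -rmorphXn /= (expX_lagrange (mN _)) linear_sum /=.
  over.
rewrite bigA_distr_bigA; apply: eq_bigr => b _.
have -> : meval (fun x => (node b x)%:R) m = \prod_(x : D) (b x)%:R ^+ m (val x).
  rewrite /meval (big_fset_incl _ mD) => [|x _]; last first.
    by rewrite -cmE_neq0 negbK => /eqP->.
  by rewrite big_seq_fsetE; apply: eq_bigr => x _; rewrite node_val.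
have -> : IntZ_val (lagrange_prod b) = \prod_(x : D) val (lagrangeZ N (val x) (b x)).
  exact: (rmorph_prod (val : {rmorphism IntZ X -> Qpoly X})).
rewrite -scaler_prod; apply: eq_bigr => x _.
by rewrite linearZ /= mulr_algl lagrangeZ_horner.
Qed.

Lemma IntZ_interp (q : IntZ X) :
    (forall m, m \in msupp (val q) -> (finsupp m `<=` D)%fset /\ forall x, m x < N)%N ->
  q = \sum_b IntZ_eval q (fun x => (node b x)%:Z) *: lagrange_prod b.
Proof.
move=> qDN; apply: val_inj; rewrite rmorph_sum /=.
transitivity (\sum_b qeval (fun x => (node b x)%:R) q *: val (lagrange_prod b)); last first.
  by apply: eq_bigr => b _; rewrite IntZ_valZ IntZ_evalE.
under eq_bigr => b _ do rewrite /qeval mmapE scaler_suml.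
rewrite exchange_big /= [LHS]monalgE; apply: eq_big_seq => m /qDN[mD mN].
rewrite malgUZ (malg_interp mD mN) scaler_sumr; apply: eq_bigr => b _.
by rewrite scalerA.
Qed.

End Nodes.

Lemma IntZ_interp_seq (s : seq (IntZ X)) : exists (D : {fset X}) (N : nat),
  forall N', (N <= N')%N -> forall q, q \in s ->
  q = \sum_(b : {ffun D -> 'I_N'}) IntZ_eval q (fun x => (node b x)%:Z) *: lagrange_prod b.
Proof.
suff [D [N DN]] : exists (D : {fset X}) (N : nat), forall q, q \in s ->
    forall m, m \in msupp (val q) -> (finsupp m `<=` D)%fset /\ forall x, (m x < N)%N.
  exists D, N => N' NN' q qs; apply: IntZ_interp => m /(DN _ qs)[mD mN].
  by split=> // x; apply: leq_trans NN'.
elim: s => [|q s [D [N DN]]]; first by exists fset0, 0.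
have [D' [N' DN']] : exists (D' : {fset X}) N', forall m, m \in msupp (val q) ->
    (finsupp m `<=` D')%fset /\ forall x, (m x < N')%N.
  exists (\bigcup_(m <- msupp (val q)) finsupp m)%fset.
  exists (\max_(m <- msupp (val q)) mdeg m).+1 => m mq; split.
    exact: (@bigfcup_sup _ _ _ _ xpredT (fun m : {cmonom X} => finsupp m)).
  move=> x; rewrite ltnS; apply: (@leq_trans (mdeg m)).
    have [xm|] := boolP (x \in finsupp m); last by rewrite -cmE_eq0 => /eqP->.
    by rewrite mdegE (big_fsetD1 x) //= leq_addr.
  exact: (@leq_bigmax_seq _ _ xpredT (fun m : {cmonom X} => mdeg m)).
exists (D `|` D')%fset, (maxn N N') => r; rewrite inE => /predU1P[->|rs] m.
  move=> /DN'[mD mN]; split=> [|x]; first by rewrite fsubsetU // mD orbT.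
  by rewrite leq_max mN orbT.
move=> /(DN _ rs)[mD mN]; split=> [|x]; first by rewrite fsubsetU // mD.
by rewrite leq_max mN.
Qed.

End InterpolationZ.

(** * Evaluation of integer-valued polynomials over Z and F_p *)

Section EvaluationZ.
Variable X : choiceType.
Implicit Types (q r : IntZ X) (a : X -> int).

Lemma IntZ_evalD q r a : IntZ_eval (q + r) a = IntZ_eval q a + IntZ_eval r a.
Proof. by apply: (@intr_inj rat); rewrite rmorphD /= !IntZ_evalE rmorphD. Qed.

Lemma IntZ_evalM q r a : IntZ_eval (q * r) a = IntZ_eval q a * IntZ_eval r a.
Proof. by apply: (@intr_inj rat); rewrite rmorphM /= !IntZ_evalE rmorphM. Qed.

Lemma IntZ_evalZ n q a : IntZ_eval (n *: q) a = n * IntZ_eval q a.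
Proof.
apply: (@intr_inj rat); rewrite rmorphM /= !IntZ_evalE IntZ_valZ.
by rewrite /qeval mmapZ.
Qed.

Lemma IntZ_eval1 a : IntZ_eval 1 a = 1.
Proof. by apply: (@intr_inj rat); rewrite IntZ_evalE rmorph1. Qed.

Lemma IntZ_eval0 a : IntZ_eval 0 a = 0.
Proof. by apply: (@intr_inj rat); rewrite IntZ_evalE rmorph0. Qed.

Lemma IntZ_eval_var x a : IntZ_eval (IntZ_var x) a = a x.
Proof. by apply: (@intr_inj rat); rewrite IntZ_evalE qeval_var. Qed.

Lemma IntZ_evalN q a : IntZ_eval (- q) a = - IntZ_eval q a.
Proof. by rewrite -scaleN1r IntZ_evalZ mulN1r. Qed.

Lemma qeval0_mcoeff (q : Qpoly X) : qeval (fun=> 0) q = mcoeff mone q.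
Proof.
rewrite {2}[q]monalgE raddf_sum /qeval mmapE; apply: eq_bigr => m _ /=.
rewrite mcoeffU; case: eqVneq => [->|m1]; first by rewrite /meval mdom1 big_seq_fset0 mulr1.
have [x xm] : exists x, x \in finsupp m.
  apply/fset0Pn; apply: contra_neq m1 => m0; apply/eqP/cmP => y.
  by apply/eqP; rewrite cm1 cmE_eq0 m0.
by rewrite /meval (big_fsetD1 x) //= expr0n cmE_eq0 xm /= mul0r mulr0.
Qed.

Lemma IntZ_zero_constE q : (q \in @IntZ_zero_const X) = (IntZ_eval q (fun=> 0) == 0).
Proof. by rewrite -(eqr_int rat) IntZ_evalE qeval0_mcoeff. Qed.

Lemma zetaZ_fact (x : X) n :
  n`!%:R *: zetaZ x n = \prod_(i < n) (IntZ_var x - i%:R).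
Proof.
apply: val_inj; rewrite natz /= IntZ_valZ /= /qbinom scalerA.
rewrite mulfV ?scale1r; last by rewrite pnatr_eq0 -lt0n fact_gt0.
rewrite (_ : IntZ_val _ = \prod_(i < n) val (IntZ_var x - i%:R)); last first.
  exact: (rmorph_prod (val : {rmorphism IntZ X -> Qpoly X})).
apply: eq_bigr => i _; rewrite rmorphB /=.
by rewrite -[IntZ_val _%:R]/(val _%:R) rmorph_nat.
Qed.

End EvaluationZ.

Section EvaluationF.
Variables (X : choiceType) (p : nat) (p_pr : prime p).
Local Notation F := (IntF X p_pr).
Local Notation pi := (\pi_F : {rmorphism IntZ X -> F}).
Implicit Types (q r : IntZ X) (a : X -> 'F_p) (u v : F).

Definition lift_Fp a : X -> int := fun x => (a x : nat)%:Z.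

Lemma eval_ideal q a : q \in @IntF_ideal X p p_pr -> (IntZ_eval q (lift_Fp a))%:~R = 0 :> 'F_p.
Proof.
move=> /asboolP[s [Gs ->]].
elim: s Gs => [|[r g] s IHs] Gs; first by rewrite big_nil IntZ_eval0.
rewrite big_cons IntZ_evalD rmorphD /= IHs ?addr0; last first.
  by move=> rg srg; apply: Gs; rewrite inE srg orbT.
rewrite -[r *: g]/(r * g : IntZ X) IntZ_evalM rmorphM /=.
have [/= [x [n [le_pn Eg]]]|/= ->] := Gs _ (mem_head _ _); last first.
  have -> : IntZ_eval p%:R (lift_Fp a) = p%:R.
    apply: (@intr_inj rat); rewrite IntZ_evalE -[IntZ_val _%:R]/(val _%:R).
    by rewrite !rmorph_nat.
  by rewrite rmorph_nat pchar_Fp_0 ?mulr0.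
(* The lift of a x lies below p, hence below n, so one factor of x (x - 1) .. (x - n + 1) vanishes
   at it. *)
have lt_an : (a x < n)%N.
  by apply: leq_trans le_pn; rewrite -{2}(Fp_cast p_pr) ltn_ord.
have -> : IntZ_eval g (lift_Fp a) = 0; last by rewrite mulr0.
apply: (@intr_inj rat); rewrite IntZ_evalE Eg.
rewrite /qbinom -mul_malgC rmorphM [X in X * _]mmapC rmorph_prod /= (bigD1 (Ordinal lt_an)) //=.
by rewrite rmorphB rmorph_nat /= qeval_var -[_%:~R]/(_%:R) subrr mul0r mulr0.
Qed.

Lemma IntF_eval_pi q a : IntF_eval (pi q) a = (IntZ_eval q (lift_Fp a))%:~R.
Proof.
apply/eqP; rewrite -subr_eq0 -rmorphB /= -IntZ_evalN -IntZ_evalD; apply/eqP/eval_ideal.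
by rewrite Quotient.idealrBE; apply/eqP; rewrite reprK.
Qed.

Lemma IntF_repr u : u = pi (repr u).
Proof. by rewrite /= reprK. Qed.

Lemma pi_scale n q : pi (n *: q) = n%:~R *: pi q.
Proof. by rewrite scaler_int -(rmorphMz pi). Qed.

Lemma IntF_evalP u v c a :
  IntF_eval (c *: u + v) a = c * IntF_eval u a + IntF_eval v a.
Proof.
have [n ->] : exists n : int, c = n%:~R by exists (c : nat)%:Z; rewrite -pmulrn natr_Zp.
rewrite (IntF_repr u) (IntF_repr v) -pi_scale -rmorphD !IntF_eval_pi.
by rewrite IntZ_evalD IntZ_evalZ rmorphD rmorphM.
Qed.

Lemma IntF_evalM u v a : IntF_eval (u * v) a = IntF_eval u a * IntF_eval v a.
Proof.
by rewrite (IntF_repr u) (IntF_repr v) -rmorphM !IntF_eval_pi IntZ_evalM rmorphM.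
Qed.

Lemma IntF_eval1 a : IntF_eval (1 : F) a = 1.
Proof. by rewrite -(rmorph1 pi) IntF_eval_pi IntZ_eval1. Qed.

Lemma IntF_eval_var x a : IntF_eval (IntF_var p_pr x) a = a x.
Proof.
rewrite (_ : IntF_var p_pr x = pi (IntZ_var x)) // IntF_eval_pi IntZ_eval_var.
by rewrite /lift_Fp -pmulrn natr_Zp.
Qed.

Lemma IntF_zero_constP u : u \in @IntF_zero_const X p p_pr <-> IntF_eval u (fun=> 0) = 0.
Proof.
split=> [/asboolP[r r0 <-]|u0].
  rewrite IntF_eval_pi; move: r0; rewrite IntZ_zero_constE => /eqP r0.
  by rewrite /lift_Fp r0.
(* The representative may have a nonzero constant term z. It reduces to 0 in F_p by hypothesis, so
   subtracting it leaves the class of u unchanged. *)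
apply/asboolP; set z := IntZ_eval (repr u) (lift_Fp (fun=> 0)).
exists (repr u - z *: 1).
  rewrite IntZ_zero_constE IntZ_evalD IntZ_evalN IntZ_evalZ IntZ_eval1 mulr1.
  by rewrite subrr.
rewrite -[LHS]/(pi _) rmorphB pi_scale -IntF_repr.
by rewrite -[z%:~R]/(IntF_eval u (fun=> 0)) u0 scale0r subr0.
Qed.

Lemma pi_zetaZ x n : (p <= n)%N -> pi (zetaZ x n) = 0.
Proof.
move=> le_pn; rewrite -(rmorph0 pi); apply/eqP; rewrite -Quotient.idealrBE subr0.
apply/asboolP; exists [:: (1, zetaZ x n)]; rewrite big_seq1 scale1r; split=> // rg.
by rewrite inE => /eqP->; left; exists x, n.
Qed.

(** Triangularity of [newton_coef] leaves only the zeta_k(x) with k >= b >= p, which lie in the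
    ideal. So only nodes with all coordinates in 0, .., p - 1 survive modulo the ideal, and these
    are lifts of points over F_p. *)
Lemma pi_lagrangeZ N x b : (p <= b)%N -> pi (lagrangeZ N x b) = 0.
Proof.
move=> le_pb; rewrite /lagrangeZ rmorph_sum big1 // => n _; rewrite pi_scale.
have [/newton_coef_gt->|le_bn] := ltnP n b; first by rewrite scale0r.
by rewrite pi_zetaZ ?scaler0 // (leq_trans le_pb).
Qed.

End EvaluationF.

(** * Pure subalgebras and interpolation over R *)

Section Evaluation.
Variables (k : coef) (X : choiceType).
Local Notation R := (coef_ring k).
Local Notation B := (IntR k X).
Implicit Types (q r : B) (a : X -> R) (c : R).

Lemma IntR_evalP c q r a : IntR_eval (c *: q + r) a = c * IntR_eval q a + IntR_eval r a.
Proof.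
case: k c q r a => [|p p_pr] c q r a; last exact: IntF_evalP.
by rewrite -[LHS]/(IntZ_eval _ _) IntZ_evalD IntZ_evalZ.
Qed.

Lemma IntR_evalM q r a : IntR_eval (q * r) a = IntR_eval q a * IntR_eval r a.
Proof. by case: k q r a => [|p p_pr] q r a; [apply: IntZ_evalM|apply: IntF_evalM]. Qed.

Lemma IntR_eval1 a : IntR_eval (1 : B) a = 1.
Proof. by case: k a => [|p p_pr] a; [apply: IntZ_eval1|apply: IntF_eval1]. Qed.

Lemma IntR_eval_var x a : IntR_eval (IntR_var k x) a = a x.
Proof. by case: k a => [|p p_pr] a; [apply: IntZ_eval_var|apply: IntF_eval_var]. Qed.

Lemma zero_constP q : q \in @zero_const k X <-> IntR_eval q (fun=> 0) = 0.
Proof.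
case: k q => [|p p_pr] q; last exact: IntF_zero_constP.
by rewrite [q \in _]IntZ_zero_constE; split=> /eqP.
Qed.

(** The last clause stands in for closure under zeta_n: it recovers zeta_n(x) from its multiple x (x
    - 1) .. (x - n + 1) whenever n! is nonzero in R. *)
Definition pure_subalgebra (P : B -> Prop) : Prop :=
  [/\ P 1, forall c q r, P q -> P r -> P (c *: q + r),
      forall q r, P q -> P r -> P (q * r), forall x, P (IntR_var k x)
    & forall c q, c != 0 -> P (c *: q) -> P q].

Section PureSubalgebra.
Variable P : B -> Prop.
Hypothesis P_pure : pure_subalgebra P.

Lemma pure0 : P 0.
Proof. by have [P1 PL _ _ _] := P_pure; have := PL (-1) _ _ P1 P1; rewrite scaleN1r addNr. Qed.

Lemma pureD q r : P q -> P r -> P (q + r).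
Proof. by have [_ PL _ _ _] := P_pure => Pq Pr; rewrite -[q]scale1r; apply: PL. Qed.

Lemma pureZ c q : P q -> P (c *: q).
Proof. by have [_ PL _ _ _] := P_pure => Pq; rewrite -[c *: q]addr0; apply: PL => //; apply: pure0. Qed.

Lemma pure_sum (I : Type) (s : seq I) (Q : pred I) (f : I -> B) :
  (forall i, P (f i)) -> P (\sum_(i <- s | Q i) f i).
Proof. by move=> Pf; apply: (big_ind P) => // [|q r]; [apply: pure0|apply: pureD]. Qed.

Lemma pure_prod (I : Type) (s : seq I) (Q : pred I) (f : I -> B) :
  (forall i, P (f i)) -> P (\prod_(i <- s | Q i) f i).
Proof. by have [P1 _ PM _ _] := P_pure => Pf; apply: (big_ind P). Qed.

Lemma pure_zeta (z : B) x n : n`!%:R != 0 :> R ->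
  n`!%:R *: z = \prod_(i < n) (IntR_var k x - i%:R) -> P z.
Proof.
have [P1 PL _ Pv Pp] := P_pure => n0 zE; apply: (Pp n`!%:R) => //; rewrite zE.
apply: pure_prod => i; rewrite addrC -scaler_nat -scaleN1r scalerA.
exact: PL.
Qed.

End PureSubalgebra.
End Evaluation.

(** The first clause records that the e_i are built from the variables by the operations of a pure
    subalgebra, so that the interpolation formula doubles as an induction principle. *)
Lemma IntR_interp k (X : choiceType) (s : seq (IntR k X)) :
  exists (I : finType) (a : I -> X -> coef_ring k) (e : I -> IntR k X),
    (forall P, pure_subalgebra P -> forall i, P (e i)) /\
    forall q, q \in s -> q = \sum_i IntR_eval q (a i) *: e i.
Proof.
case: k s => [|p p_pr] s.
  have [D [N DN]] := IntZ_interp_seq s.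
  exists {ffun D -> 'I_N}, (fun b x => (node b x)%:Z), (fun b => lagrange_prod b).
  split=> [P P_pure b|q qs]; last exact: DN.
  apply: (pure_prod P_pure) => x; apply: (pure_sum P_pure) => n; apply: (pureZ P_pure).
  apply: (@pure_zeta CoefZ X _ P_pure (zetaZ (val x) n) (val x) n); last exact: zetaZ_fact.
  by rewrite -[_%:R]/(n`!%:R : int) natz -lt0n fact_gt0.
pose F := IntF X p_pr; pose pi := (\pi_F : {rmorphism IntZ X -> F}).
(* Integral representatives are interpolated, and the formula is then reduced modulo the ideal. *)
have [D [N DN]] := IntZ_interp_seq [seq repr u | u : F <- s].
exists {ffun D -> 'I_N}, (fun b x => (node b x)%:R), (fun b => pi (lagrange_prod b)).
split=> [P P_pure b|q qs].
  rewrite rmorph_prod; apply: (pure_prod P_pure) => x.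
  rewrite rmorph_sum; apply: (pure_sum P_pure) => n.
  rewrite pi_scale; apply: (pureZ P_pure).
  have [le_pn|lt_np] := leqP p n; first by rewrite pi_zetaZ //; apply: (pure0 P_pure).
  apply: (@pure_zeta (CoefF p_pr) X _ P_pure (pi (zetaZ (val x) n)) (val x) n).
    rewrite -[_%:R]/(n`!%:R : 'F_p) -(dvdn_pcharf (pchar_Fp p_pr)).
    by apply/negP => /(prime_dvd_fact p_pr); rewrite leqNgt lt_np.
  have := congr1 pi (zetaZ_fact (val x) n); rewrite pi_scale rmorph_nat => ->.
  by rewrite rmorph_prod; apply: eq_bigr => i _; rewrite rmorphB rmorph_nat.
have {}qs : repr q \in [seq repr u | u : F <- s] by apply: map_f.
have -> : q = pi (repr q) by rewrite /= reprK.
rewrite {1}(DN _ (leqnn _) _ qs) rmorph_sum; apply: eq_bigr => b _.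
rewrite pi_scale -[IntR_eval _ _]/(IntF_eval (pi (repr q)) _) IntF_eval_pi.
(* A node with a coordinate at least p contributes 0; any other node is the canonical lift of its
   reduction, where the value of q is the reduction of the integral value. *)
have [/existsP[x le_pb]|] := boolP [exists x : D, p <= b x]%N.
  suff -> : pi (lagrange_prod b) = 0 by rewrite !scaler0.
  by rewrite rmorph_prod (bigD1 x) //= pi_lagrangeZ ?mul0r.
rewrite negb_exists => /forallP lt_bp; congr ((IntZ_eval _ _)%:~R *: _).
apply: funext => x; rewrite /lift_Fp /node; case: insubP => [x' _ _|_].
  by rewrite val_Fp_nat // modn_small // ltnNge lt_bp.
by rewrite val_Fp_nat // mod0n.
Qed.

Lemma IntR_ind k (X : choiceType) (P : IntR k X -> Prop) :
  pure_subalgebra P -> forall q, P q.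
Proof.
move=> P_pure q; have [I [a [e [Pe qE]]]] := IntR_interp [:: q].
rewrite (qE q (mem_head _ _)); apply: (pure_sum P_pure) => i.
by apply: (pureZ P_pure); apply: Pe.
Qed.

(** * Tensor powers *)

Section LinearMaps.
Variables (R : pzRingType) (V W : lmodType R) (f : V -> W).
Hypothesis f_lin : linear f.

Lemma lin0 : f 0 = 0.
Proof. by have := f_lin (-1) 0 0; rewrite scaler0 addr0 scaleN1r addNr. Qed.

Lemma linD u v : f (u + v) = f u + f v.
Proof. by rewrite -[u in LHS]scale1r f_lin scale1r. Qed.

Lemma linZ r u : f (r *: u) = r *: f u.
Proof. by rewrite -[r *: u]addr0 f_lin lin0 addr0. Qed.

Lemma linN u : f (- u) = - f u.
Proof. by rewrite -scaleN1r linZ scaleN1r. Qed.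

Lemma lin_sum (I : Type) (s : seq I) (P : pred I) (g : I -> V) :
  f (\sum_(i <- s | P i) g i) = \sum_(i <- s | P i) f (g i).
Proof. exact: (big_morph f linD lin0). Qed.

Lemma linB5 a b c d e : f (- a - b + c + d - e) = - f a - f b + f c + f d - f e.
Proof. by rewrite linD linN linD linD linD !linN. Qed.

End LinearMaps.

Lemma linear_comb (R : comNzRingType) (V W : lmodType R) (f g : V -> W) c :
  linear f -> linear g -> linear (fun v => c *: f v + g v).
Proof.
by move=> f_lin g_lin r u v; rewrite f_lin g_lin !scalerDr addrACA !scalerA mulrC.
Qed.

Section TensorPowers.
Variables (R : comNzRingType) (U : lmodType R).
Local Notation T := (tpow U).

Lemma tnth_tset n (t : n.-tuple U) i u j : tnth (tset t i u) j = if j == i then u else tnth t j.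
Proof. by rewrite tnth_mktuple. Qed.

Lemma tens_multilinear n : multilinear (@tens R U n).
Proof.
move=> t i r u u'.
pose pi := \pi_(lquot (@tens_rel R U n)) : 
  {additive {malg R[n.-tuple U]} -> lquot (@tens_rel R U n)}.
rewrite -[LHS]/(pi _) -[RHS]/(r *: pi _ + pi _).
have piZ v : r *: pi v = pi (r *: v) by apply: lquot_scale_pi.
rewrite piZ.
rewrite -raddfD; apply/eqP; rewrite -Quotient.idealrBE; apply/asboolP.
exists [:: (1, << tset t i (r *: u + u') >> - r *: << tset t i u >> - << tset t i u' >>)].
rewrite big_seq1 scale1r opprD addrA; split=> // rg; rewrite inE => /eqP->.
by exists t, i, r, u, u'.
Qed.

Lemma tpow_ind n (P : T n -> Prop) :
  (forall r u v, P u -> P v -> P (r *: u + v)) -> (forall t, P (tens t)) -> forall u, P u.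
Proof.
move=> PL Pt.
have P0 : P 0.
  have Pt0 := Pt [tuple 0 | i < n].
  by have := PL (-1) _ _ Pt0 Pt0; rewrite scaleN1r addNr.
move=> u; rewrite -[u]lquotK [repr u]monalgE raddf_sum /=.
apply: (big_ind P) => [|v w Pv Pw|t _]; first exact: P0.
  by rewrite -[v]scale1r; apply: PL.
have -> : << (repr u)@_t *g t >> = (repr u)@_t *: << t >> :> {malg R[n.-tuple U]}.
  by apply/malgP => t'; rewrite mcoeffZ !mcoeffU mulrnAr mulr1.
rewrite -lquot_scale_pi -[lquot_scale _ _]addr0; apply: PL; last exact: P0.
exact: Pt.
Qed.

Lemma tpow_ext n (W : lmodType R) (f g : T n -> W) : linear f -> linear g ->
  (forall t, f (tens t) = g (tens t)) -> forall u, f u = g u.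
Proof.
move=> f_lin g_lin fg; apply: tpow_ind => // r u v fu fv.
by rewrite f_lin g_lin fu fv.
Qed.

Lemma tuple2E (t : 2.-tuple U) : t = [tuple tnth t ord0; tnth t ord_max].
Proof.
apply: eq_from_tnth => i; case: (unliftP ord0 i) => [j ->|->] //.
by rewrite ord1; congr tnth; apply: val_inj.
Qed.

Lemma multilinear2 (W : lmodType R) (f : U -> U -> W) :
    (forall b, linear (f^~ b)) -> (forall a, linear (f a)) ->
  multilinear (fun t : 2.-tuple U => f (tnth t ord0) (tnth t ord_max)).
Proof.
move=> fl fr t i r u u'; rewrite !tnth_tset.
case: (unliftP ord0 i) => [j ->|->] /=; last exact: fl.
rewrite ord1 (_ : lift ord0 ord0 = ord_max); last exact: val_inj.
exact: fr.
Qed.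

End TensorPowers.

(** * The augmentation ideal *)

Section MaximalIdeal.
Variables (k : coef) (X : choiceType).
Local Notation R := (coef_ring k).
Local Notation B := (IntR k X).
Local Notation m := (maug k X).
Local Notation M := (X -> R).
Implicit Types (q r : m) (a : M) (c : R).

Definition evm q a : R := IntR_eval (val q) a.

Lemma evmP c q r a : evm (c *: q + r) a = c * evm q a + evm r a.
Proof. exact: IntR_evalP. Qed.

Lemma evmM q r a : evm (maug_mul q r) a = evm q a * evm r a.
Proof. exact: IntR_evalM. Qed.

Lemma evm0 q : evm q (fun=> 0) = 0.
Proof. exact/zero_constP/valP. Qed.

Lemma maug_mul_linl r : linear (@maug_mul k X ^~ r).
Proof. by move=> c q q'; apply: val_inj; rewrite /= mulrDl scalerAl. Qed.

Lemma maug_mul_linr q : linear (@maug_mul k X q).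
Proof. by move=> c r r'; apply: val_inj; rewrite /= mulrDr scalerAr. Qed.

Lemma augment_proof (b : B) : b - IntR_eval b (fun=> 0) *: 1 \in @zero_const k X.
Proof. by apply/zero_constP; rewrite addrC -scaleNr IntR_evalP IntR_eval1 mulr1 addNr. Qed.

(** The projection of Int(R^X) onto m along the constants. It moves the e_i of an interpolation
    formula, which may have constant terms, into m, and carries inductions on Int(R^X) over to m. *)
Definition augment (b : B) : m := MkMaug (augment_proof b).

Lemma evm_augment b a : evm (augment b) a = IntR_eval b a - IntR_eval b (fun=> 0).
Proof. by rewrite /evm /= addrC -scaleNr IntR_evalP IntR_eval1 mulr1 addrC. Qed.

Lemma augmentK q : augment (val q) = q.
Proof. by apply: val_inj; rewrite /= [IntR_eval _ _]evm0 scale0r subr0. Qed.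

Lemma augment_linear : linear augment.
Proof.
move=> c b b'; apply: val_inj; rewrite /= IntR_evalP scalerDl -scalerA opprD addrACA.
by rewrite scalerBr.
Qed.

Lemma maug_interp (s : seq m) : exists (I : finType) (a : I -> M) (e : I -> m),
  forall q, q \in s -> q = \sum_i evm q (a i) *: e i.
Proof.
have [I [a [e [_ eE]]]] := IntR_interp [seq val q | q <- s].
exists I, a, (augment \o e) => q qs.
rewrite -[LHS]augmentK {1}(eE _ (map_f _ qs)) (lin_sum augment_linear).
by apply: eq_bigr => i _; rewrite (linZ augment_linear).
Qed.

End MaximalIdeal.

(** * Realization of tensors as cochains *)

Section Realization.
Variables (k : coef) (X : choiceType).
Local Notation R := (coef_ring k).
Local Notation m := (maug k X).
Local Notation T := (tpow m).
Local Notation M := (X -> R).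
Local Notation C := (cochain R M).

Lemma iota1_linear : linear (@iota1 k X).
Proof.
move=> c q r; have := tens_multilinear [tuple 0] ord0 c q r.
have E u : tset [tuple 0] ord0 u = [tuple u] :> 1.-tuple m.
  by apply: eq_from_tnth => i; rewrite tnth_tset !ord1.
by rewrite !E.
Qed.

Lemma deg1_spec : linear (@deg1 k X) /\ forall q : m, deg1 (iota1 q) = q.
Proof.
have [|lin_deg1 deg1E] := @tlift_spec _ m 1 m (fun t => thead t).
  by move=> t i c q r; rewrite /thead !tnth_tset !ord1.
by split=> // q; rewrite /deg1 /iota1 deg1E.
Qed.

Lemma deg1_linear : linear (@deg1 k X). Proof. by have [] := deg1_spec. Qed.
Lemma iota1K (q : m) : deg1 (iota1 q) = q. Proof. by have [_ ->] := deg1_spec. Qed.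

Lemma deg1K (u : T 1) : iota1 (deg1 u) = u.
Proof.
apply: (tpow_ext (f := fun u => iota1 (deg1 u))) u => // [c u v|t].
  by rewrite deg1_linear iota1_linear.
have -> : t = [tuple thead t] by apply: eq_from_tnth => i; rewrite ord1.
by rewrite -[tens _]/(iota1 _) iota1K.
Qed.

Lemma tcup1_iota1 (q r : m) : tcup1 (iota1 q) (iota1 r) = iota1 (maug_mul q r).
Proof.
exact: (f_equal2 (fun a b => iota1 (maug_mul a b)) (iota1K q) (iota1K r)).
Qed.

Lemma tlift2_spec (W : lmodType R) (f : m -> m -> W) :
    (forall b, linear (f^~ b)) -> (forall a, linear (f a)) ->
  linear (tlift2 f) /\ forall a b, tlift2 f (tens2 a b) = f a b.
Proof.
move=> fl fr; have [lin_f fE] := tlift_spec (multilinear2 fl fr).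
by split=> // a b; rewrite /tlift2 fE.
Qed.

Lemma tpow2_ext (W : lmodType R) (f g : T 2 -> W) : linear f -> linear g ->
  (forall a b, f (tens2 a b) = g (tens2 a b)) -> forall u, f u = g u.
Proof. by move=> f_lin g_lin fg; apply: tpow_ext => // t; rewrite [t]tuple2E fg. Qed.

Lemma tens2_linl b : linear (@tens2 k X ^~ b).
Proof.
move=> c q r; have := tens_multilinear [tuple 0; b] ord0 c q r.
have E u : tset [tuple 0; b] ord0 u = [tuple u; b] :> 2.-tuple m.
  by rewrite [LHS]tuple2E !tnth_tset.
by rewrite !E.
Qed.

Lemma tens2_linr a : linear (@tens2 k X a).
Proof.
move=> c q r; have := tens_multilinear [tuple a; 0] ord_max c q r.
have E u : tset [tuple a; 0] ord_max u = [tuple a; u] :> 2.-tuple m.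
  by rewrite [LHS]tuple2E !tnth_tset.
by rewrite !E.
Qed.

Section Cup.
Variables i j : nat.
Implicit Types (u : T i) (v : T j) (s : i.-tuple m) (t : j.-tuple m).

Lemma cat_tset_l s t l q : cat_tuple (tset s l q) t = tset (cat_tuple s t) (lshift j l) q.
Proof.
apply: eq_from_tnth => n; rewrite tnth_tset; case: (split_ordP n) => n' ->.
  by rewrite !tnth_lshift tnth_tset eq_lshift.
by rewrite !tnth_rshift eq_rlshift.
Qed.

Lemma cat_tset_r s t l q : cat_tuple s (tset t l q) = tset (cat_tuple s t) (rshift i l) q.
Proof.
apply: eq_from_tnth => n; rewrite tnth_tset; case: (split_ordP n) => n' ->.
  by rewrite !tnth_lshift eq_lrshift.
by rewrite !tnth_rshift tnth_tset eq_rshift.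
Qed.

Let cat_spec s : linear (tlift (fun t => tens (cat_tuple s t))) /\
  forall t, tlift (fun t => tens (cat_tuple s t)) (tens t) = tens (cat_tuple s t).
Proof.
apply: tlift_spec => t l c q r.
by rewrite !cat_tset_r; apply: tens_multilinear.
Qed.

Let cup_spec v : linear (fun u => tcup u v) /\
  forall s, tcup (tens s) v = tlift (fun t => tens (cat_tuple s t)) v.
Proof.
apply: tlift_spec => s l c q r.
(* Multilinearity in s is an equality between maps linear in v, so it can be tested on pure
   tensors. *)
apply: (tpow_ext (f := tlift _)
  (g := fun v => c *: tlift (fun t => tens (cat_tuple (tset s l q) t)) v
               + tlift (fun t => tens (cat_tuple (tset s l r) t)) v)).
- by have [] := cat_spec (tset s l (c *: q + r)).
- have [lin1 _] := cat_spec (tset s l q); have [lin2 _] := cat_spec (tset s l r).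
  exact: (linear_comb c lin1 lin2).
move=> t; have [_ ->] := cat_spec (tset s l (c *: q + r)).
have [_ ->] := cat_spec (tset s l q); have [_ ->] := cat_spec (tset s l r).
by rewrite !cat_tset_l; apply: tens_multilinear.
Qed.

Lemma tcup_linl v : linear (fun u => tcup u v). Proof. by have [] := cup_spec v. Qed.

Lemma tcup_tens s t : tcup (tens s) (tens t) = tens (cat_tuple s t).
Proof. by have [_ ->] := cup_spec (tens t); have [_ ->] := cat_spec s. Qed.

Lemma tcup_linr u : linear (tcup u : T j -> _).
Proof.
move=> c v v'; apply: (tpow_ext (f := fun u => tcup u (c *: v + v'))
  (g := fun u => c *: tcup u v + tcup u v')) u => [||s].
- exact: tcup_linl.
- exact: (linear_comb c (tcup_linl v) (tcup_linl v')).
have [_ ->] := cup_spec (c *: v + v'); have [_ ->] := cup_spec v.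
by have [_ ->] := cup_spec v'; have [->] := cat_spec s.
Qed.

End Cup.

Lemma tens_cons n (q : m) (t : n.-tuple m) :
  tens [tuple of q :: t] = tcup (iota1 q) (tens t) :> T n.+1.
Proof. by rewrite tcup_tens; congr tens; apply: val_inj. Qed.

Lemma tcup_iota1 (q r : m) : tcup (iota1 q) (iota1 r) = tens2 q r.
Proof. by rewrite tcup_tens; congr tens; apply: val_inj. Qed.

(* Opaque, so that unification never unfolds the lift from tensor powers. *)
Lemma psi_sig n : {f : T n -> C n | linear f /\
  forall t, f (tens t) = fun s => \prod_(i < n) evm (tnth t i) (s i)}.
Proof.
exists (@tlift R m n (C n) (fun t s => \prod_(i < n) evm (tnth t i) (s i))).
apply: tlift_spec => t i c q r; apply: funext => s.
have E u : \prod_(j < n) evm (tnth (tset t i u) j) (s j)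
    = evm u (s i) * \prod_(j < n | j != i) evm (tnth t j) (s j).
  rewrite (bigD1 i) //= tnth_tset eqxx; congr (_ * _).
  by apply: eq_bigr => j /negPf ji; rewrite tnth_tset ji.
by rewrite -[RHS]/(c * _ + _) !E evmP; ring.
Qed.

Definition psi n : T n -> C n := sval (psi_sig n).

Lemma psi_linear n : linear (@psi n). Proof. by have [] := svalP (psi_sig n). Qed.

Lemma psi_tens n (t : n.-tuple m) s : psi (tens t) s = \prod_(i < n) evm (tnth t i) (s i).
Proof. by rewrite /psi; have [_ ->] := svalP (psi_sig n). Qed.

Lemma psi_iota1 (q : m) s : psi (iota1 q) s = evm q (s ord0).
Proof. by rewrite psi_tens big_ord1. Qed.

Lemma psi1E (u : T 1) s : psi u s = evm (deg1 u) (s ord0).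
Proof. by rewrite -[u in LHS]deg1K psi_iota1. Qed.

Lemma psi_tens2 (q r : m) s : psi (tens2 q r) s = evm q (s ord0) * evm r (s ord_max).
Proof.
rewrite psi_tens big_ord_recl big_ord1; congr (evm _ _ * evm _ (s _)).
exact: val_inj.
Qed.

Lemma psi_one : psi (tens [tuple]) = fun=> 1.
Proof. by apply: funext => s; rewrite psi_tens big_ord0. Qed.

Lemma cochain_cup_linl i j (g : C j) : linear (fun f : C i => cochain_cup f g : C (i + j)).
Proof. by have [H _ _ _ _] := @bar_graded_algebra R M (fun=> 0); apply: H. Qed.

Lemma cochain_cup_linr i j (f : C i) : linear (fun g : C j => cochain_cup f g : C (i + j)).
Proof. by have [_ H _ _ _] := @bar_graded_algebra R M (fun=> 0); apply: H. Qed.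

Lemma psi_cup i j (u : T i) (v : T j) : psi (tcup u v) = cochain_cup (psi u) (psi v).
Proof.
apply: (tpow_ext (f := fun u => psi (tcup u v))
  (g := fun u => cochain_cup (psi u) (psi v) : C (i + j))) u.
- by move=> c u u'; rewrite tcup_linl psi_linear.
- by move=> c u u'; rewrite psi_linear cochain_cup_linl.
move=> s; apply: (tpow_ext (f := fun v => psi (tcup (tens s) v))
  (g := fun v => cochain_cup (psi (tens s)) (psi v) : C (i + j))) v.
- by move=> c v v'; rewrite tcup_linr psi_linear.
- by move=> c v v'; rewrite psi_linear cochain_cup_linr.
move=> t; apply: funext => x; rewrite tcup_tens psi_tens big_split_ord /cochain_cup !psi_tens.
by congr (_ * _); apply: eq_bigr => l _; rewrite ?tnth_lshift ?tnth_rshift.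
Qed.

Lemma psi_cup1 (u v : T 1) : psi (tcup1 u v) = cochain_cup1 (psi u) (psi v).
Proof. by apply: funext => s; rewrite /cochain_cup1 psi_iota1 evmM !psi1E. Qed.

Lemma tcup21_spec (u : T 1) : linear (fun w => tcup21 w u) /\ forall a b,
  tcup21 (tens2 a b) u = tens2 (maug_mul a (deg1 u)) b + tens2 a (maug_mul b (deg1 u)).
Proof.
apply: tlift2_spec => [b|a] c q r.
  by rewrite maug_mul_linl !tens2_linl scalerDr addrACA.
by rewrite maug_mul_linl !tens2_linr scalerDr addrACA.
Qed.

Lemma psi_cup21 (w : T 2) (u : T 1) : psi (tcup21 w u) = cochain_cup21 (psi w) (psi u).
Proof.
have [lin21 E21] := tcup21_spec u; apply: (tpow2_ext (f := fun w => psi (tcup21 w u))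
  (g := fun w => cochain_cup21 (psi w) (psi u) : C 2)) w.
- by move=> c w w'; rewrite lin21 psi_linear.
- move=> c w w'; rewrite psi_linear; apply: funext => s.
  by rewrite -[LHS]/((c * _ + _) * _) -[RHS]/(c * (_ * _) + _ * _); ring.
move=> a b; apply: funext => s; rewrite E21 (linD (@psi_linear 2)).
rewrite -[LHS]/(psi (tens2 (maug_mul a (deg1 u)) b) s
  + psi (tens2 a (maug_mul b (deg1 u))) s).
rewrite /cochain_cup21 !psi1E; move: (deg1 u) => q.
move: (psi_tens2 (maug_mul a q) b s) (psi_tens2 a (maug_mul b q) s) (psi_tens2 a b s).
(* [generalize] is syntactic: [rewrite] would compare the tensors by conversion. *)
generalize (psi (tens2 (maug_mul a q) b) s) (psi (tens2 a (maug_mul b q)) s)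
  (psi (tens2 a b) s) => x y z -> -> ->.
by rewrite !evmM; ring.
Qed.

Lemma tcirc_inner_spec a1 a2 :
  linear (tlift2 (fun b1 b2 : m => tens2 (maug_mul a1 b1) (maug_mul a2 b2))) /\
  forall b1 b2, tlift2 (fun b1 b2 => tens2 (maug_mul a1 b1) (maug_mul a2 b2)) (tens2 b1 b2)
    = tens2 (maug_mul a1 b1) (maug_mul a2 b2).
Proof.
apply: tlift2_spec => [b|a] c q r; first by rewrite maug_mul_linr tens2_linl.
by rewrite maug_mul_linr tens2_linr.
Qed.

Lemma tcirc_spec (w : T 2) : linear (fun v => tcirc v w) /\ forall a1 a2,
  tcirc (tens2 a1 a2) w
    = tlift2 (fun b1 b2 => tens2 (maug_mul a1 b1) (maug_mul a2 b2)) w.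
Proof.
apply: tlift2_spec => [a2|a1] c q r.
  apply: (tpow2_ext (f := tlift2 _) (g := fun w =>
    c *: tlift2 (fun b1 b2 => tens2 (maug_mul q b1) (maug_mul a2 b2)) w +
    tlift2 (fun b1 b2 => tens2 (maug_mul r b1) (maug_mul a2 b2)) w)) w.
  - by have [] := tcirc_inner_spec (c *: q + r) a2.
  - have [lin1 _] := tcirc_inner_spec q a2; have [lin2 _] := tcirc_inner_spec r a2.
    exact: (linear_comb c lin1 lin2).
  move=> b1 b2; have [_ E1] := tcirc_inner_spec (c *: q + r) a2.
  have [_ E2] := tcirc_inner_spec q a2; have [_ E3] := tcirc_inner_spec r a2.
  apply: etrans (E1 b1 b2) _; rewrite maug_mul_linl tens2_linl.
  exact: (esym (f_equal2 (fun u v => c *: u + v) (E2 b1 b2) (E3 b1 b2))).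
apply: (tpow2_ext (f := tlift2 _) (g := fun w =>
  c *: tlift2 (fun b1 b2 => tens2 (maug_mul a1 b1) (maug_mul q b2)) w +
  tlift2 (fun b1 b2 => tens2 (maug_mul a1 b1) (maug_mul r b2)) w)) w.
- by have [] := tcirc_inner_spec a1 (c *: q + r).
- have [lin1 _] := tcirc_inner_spec a1 q; have [lin2 _] := tcirc_inner_spec a1 r.
  exact: (linear_comb c lin1 lin2).
move=> b1 b2; have [_ E1] := tcirc_inner_spec a1 (c *: q + r).
have [_ E2] := tcirc_inner_spec a1 q; have [_ E3] := tcirc_inner_spec a1 r.
apply: etrans (E1 b1 b2) _; rewrite maug_mul_linl tens2_linr.
exact: (esym (f_equal2 (fun u v => c *: u + v) (E2 b1 b2) (E3 b1 b2))).
Qed.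

Lemma psi_circ (v w : T 2) : psi (tcirc v w) = cochain_circ (psi v) (psi w).
Proof.
have [lin_v Ev] := tcirc_spec w; apply: (tpow2_ext (f := fun v => psi (tcirc v w))
  (g := fun v => cochain_circ (psi v) (psi w) : C 2)) v.
- by move=> c v v'; rewrite lin_v psi_linear.
- move=> c v v'; rewrite psi_linear; apply: funext => s.
  by rewrite -[LHS]/((c * _ + _) * _) -[RHS]/(c * (_ * _) + _ * _); ring.
move=> a1 a2; rewrite Ev {lin_v Ev}; have [lin_w Ew] := tcirc_inner_spec a1 a2.
apply: (tpow2_ext (f := fun w => psi (tlift2 _ w))
  (g := fun w => cochain_circ (psi (tens2 a1 a2)) (psi w) : C 2)) w.
- by move=> c w w'; rewrite lin_w psi_linear.
- move=> c w w'; rewrite psi_linear; apply: funext => s.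
  by rewrite -[LHS]/(_ * (c * _ + _)) -[RHS]/(c * (_ * _) + _ * _); ring.
move=> b1 b2; rewrite Ew; apply: funext => s.
rewrite /cochain_circ.
move: (psi_tens2 (maug_mul a1 b1) (maug_mul a2 b2) s) (psi_tens2 a1 a2 s) (psi_tens2 b1 b2 s).
generalize (psi (tens2 (maug_mul a1 b1) (maug_mul a2 b2)) s) (psi (tens2 a1 a2) s)
  (psi (tens2 b1 b2) s) => x y z -> -> ->.
by rewrite !evmM; ring.
Qed.

(** At w = tau(x) the left side is the correction term of [mu]; through this identity mu_tau is
    expressed by the realization. *)
Lemma tlift2_evm (w : T 2) (s : simplex M 2) :
  tlift2 (fun q r => evm q (s ord0) * evm r (s ord_max) : R^o) w = psi w s.
Proof.
have [||lin_w Ew] := @tlift2_spec R^o (fun q r => evm q (s ord0) * evm r (s ord_max)).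
- by move=> b c q r; rewrite evmP -[RHS]/(c * _ + _); ring.
- by move=> a c q r; rewrite evmP -[RHS]/(c * _ + _); ring.
apply: (tpow2_ext (f := tlift2 _) (g := fun w => psi w s : R^o)) w => //.
  by move=> c w w'; rewrite psi_linear.
by move=> a b; rewrite Ew psi_tens2.
Qed.

Definition scons n (a : M) (s : simplex M n) : simplex M n.+1 := fun j =>
  if unlift ord0 j is Some j' then s j' else a.

(* Interpolating one tensor factor at a time recovers a tensor from finitely many
   values of its realization. *)
Lemma tens_interp (l : seq m) n : exists rec : C n -> T n, linear rec /\
  forall t : n.-tuple m, (forall i, tnth t i \in l) -> rec (psi (tens t)) = tens t.
Proof.
have [I [a [e eE]]] := maug_interp l.
elim: n => [|n [rec [rec_lin recE]]].
  exists (fun f => f (fun=> fun=> 0) *: tens [tuple]); split=> [c f g|t _].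
    by rewrite scalerA -scalerDl.
  rewrite psi_tens big_ord0 scale1r; congr tens; apply: val_inj; exact/esym/size0nil/size_tuple.
exists (fun f => \sum_i tcup (iota1 (e i)) (rec (fun s => f (scons (a i) s)))).
split=> [c f g|t tl].
  rewrite scaler_sumr -big_split; apply: eq_bigr => i _.
  exact: (etrans (congr1 (tcup (iota1 (e i))) (rec_lin c (fun s => f (scons (a i) s))
    (fun s => g (scons (a i) s)))) (tcup_linr _ c _ _)).
have tE : t = [tuple of thead t :: behead_tuple t] by apply: tuple_eta.
have psiE i : (fun s => psi (tens t) (scons (a i) s))
    = evm (thead t) (a i) *: psi (tens (behead_tuple t)) :> C n.
  apply: funext => s; rewrite -[RHS]/(_ * _) !psi_tens big_ord_recl /scons unlift_none.
  congr (_ * _); apply: eq_bigr => j _; rewrite liftK; congr (evm _ _).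
  by rewrite [in LHS]tE tnthS.
have {psiE} recE' i : rec (fun s => psi (tens t) (scons (a i) s))
    = evm (thead t) (a i) *: tens (behead_tuple t).
  rewrite psiE (linZ rec_lin) recE // => j.
  by have := tl (lift ord0 j); rewrite {1}tE tnthS.
under eq_bigr => i _ do rewrite recE'.
rewrite [in RHS]tE tens_cons; set v := tens (behead_tuple t).
rewrite [in RHS](eE (thead t)) ?tl // (lin_sum iota1_linear).
have L := lin_sum (tcup_linl v) (index_enum I) xpredT
  (fun i => iota1 (evm (thead t) (a i) *: e i)).
apply: (etrans _ (esym L)); apply: eq_bigr => i _.
rewrite (linZ iota1_linear).
exact: (etrans (linZ (tcup_linr _) _ _) (esym (linZ (tcup_linl v) _ _))).
Qed.

(** The left inverse of [tens_interp] is valid only for tensors with factors in a fixed finite list.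
    The list is read off an expression of u - v by pure tensors; quantifying over every [rec] valid
    on it lets the lists of two summands be concatenated. *)
Lemma psi_inj n : injective (@psi n).
Proof.
suff rec_ex (u : T n) : exists l : seq m, forall rec : C n -> T n, linear rec ->
    (forall t : n.-tuple m, (forall i, tnth t i \in l) -> rec (psi (tens t)) = tens t) ->
    rec (psi u) = u.
  move=> u v uv; apply/eqP; rewrite -subr_eq0; apply/eqP.
  have [l lE] := rec_ex (u - v); have [rec [rec_lin recE]] := tens_interp l n.
  rewrite -(lE _ rec_lin recE) (linD (@psi_linear n)) (linN (@psi_linear n)) uv subrr.
  exact: lin0.
elim/tpow_ind: u => [c u v [l lE] [l' lE']|t].
  exists (l ++ l') => rec rec_lin recE; rewrite psi_linear rec_lin lE ?lE' // => t tl;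
    by apply: recE => i; rewrite mem_cat tl ?orbT.
by exists t => rec _ recE; apply: recE => i; apply: mem_tnth.
Qed.

End Realization.

(** * Transport of structure along an injective morphism *)

Lemma gcast_morphism (R : comNzRingType) (A B : cupone_alg R) (f : forall n, A n -> B n)
  i j (e : i = j) (u : A i) : f j (gcast e u) = gcast e (f i u).
Proof. by case: j / e. Qed.

Section Pullback.
Variables (R : comNzRingType) (A B : cupone_alg R).
Variables (dA : degree1_map A) (dB : degree1_map B) (f : forall n, A n -> B n).
Hypothesis f_lin : forall n, linear (@f n).
Hypothesis f_inj : forall n, injective (@f n).
Hypothesis f1 : f (gr1 A) = gr1 B.
Hypothesis f_cup : forall i j (a : A i) (b : A j), f (cup a b) = cup (f a) (f b).
Hypothesis f_cup1 : forall a b : A 1, f (cup1 a b) = cup1 (f a) (f b).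
Hypothesis f_cup21 : forall (w : A 2) (a : A 1), f (cup21 w a) = cup21 (f w) (f a).
Hypothesis f_circ : forall v w : A 2, f (circ v w) = circ (f v) (f w).
Hypothesis f_d : forall n (a : A n), f (dA a) = dB (f a).
Hypothesis decompA : forall w : A 2, w \in @decomp R A.
Hypothesis B_cupone : is_cupone_dga dB.

(** Some axioms of B hold only on decomposable elements; this makes them available on the image of
    f. *)
Lemma f_decomp w : f w \in @decomp R B.
Proof.
have /asboolP[s [Gs ->]] := decompA w; apply/asboolP.
exists [seq (rg.1, f rg.2) | rg <- s]; split.
  move=> _ /mapP[rg /Gs[a [b rgE]] ->]; exists (f a), (f b).
  by rewrite /= rgE f_cup.
by rewrite big_map (lin_sum (@f_lin 2)); apply: eq_bigr => rg _; rewrite (linZ (@f_lin 2)).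
Qed.

Lemma pullback_graded_algebra : is_graded_algebra A.
Proof.
have [[[cupl cupr cupA cup1l cup1r] _ _ _] _ _ _] := B_cupone; split.
- by move=> i j b r a a'; apply: f_inj; rewrite f_lin !f_cup f_lin cupl.
- by move=> i j a r b b'; apply: f_inj; rewrite f_lin !f_cup f_lin cupr.
- by move=> i j l a b c; apply: f_inj; rewrite gcast_morphism !f_cup cupA.
- by move=> i a; apply: f_inj; rewrite (f_cup (gr1 A) a) f1 cup1l.
- by move=> i a; apply: f_inj; rewrite gcast_morphism f_cup f1 cup1r.
Qed.

Lemma pullback_dga : is_dga dA.
Proof.
have [[_ d_lin dd leib] _ _ _] := B_cupone; split; first exact: pullback_graded_algebra.
- by move=> n r a b; apply: f_inj; rewrite f_lin !f_d f_lin d_lin.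
- by move=> n a; apply: f_inj; rewrite !f_d dd (lin0 (@f_lin _)).
- move=> i j a b; apply: f_inj; rewrite (linD (@f_lin _)) (linZ (@f_lin _)).
  by rewrite gcast_morphism f_d !f_cup (f_cup (dA a) b) leib !f_d.
Qed.

Lemma pullback_unitized : comm_algebra (uone A) (@umul R A).
Proof.
have [_ _ _ [[umC umA um1 umr] _ _ _ _]] := B_cupone.
pose F (x : unitized A) : unitized B := (x.1, f x.2).
have F_inj : injective F by move=> [r a] [s b] [-> /f_inj->].
have FM x y : F (umul x y) = umul (F x) (F y).
  congr pair; rewrite /= (linD (@f_lin 1)) (linD (@f_lin 1)) f_cup1.
  by rewrite !(linZ (@f_lin 1)).
have F_lin r x y : F (r *: x + y) = r *: F x + F y.
  by congr pair; rewrite /= (linD (@f_lin 1)) (linZ (@f_lin 1)).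
split.
- by move=> x y; apply: F_inj; rewrite !FM umC.
- by move=> x y z; apply: F_inj; rewrite !FM umA.
- move=> x; apply: F_inj; rewrite FM -[RHS]um1; congr umul.
  by congr pair; rewrite /= (lin0 (@f_lin 1)).
- by move=> x r y z; apply: F_inj; rewrite FM !F_lin !FM umr.
Qed.

(** Each axiom is an equation between terms in operations that f preserves, or membership in
    [decomp], which is everything in A. The equations hold in B, and f is injective. *)
Lemma pullback_cupone_dga : is_cupone_dga dA.
Proof.
have [_ [c1l c1r c21l c21r] [_ cil cir] [_ ax2 ax3 ax4 ax5]] := B_cupone.
split; first exact: pullback_dga.
- split.
  + by move=> b r a a'; apply: f_inj; rewrite f_lin !f_cup1 f_lin c1l.
  + by move=> a r b b'; apply: f_inj; rewrite f_lin !f_cup1 f_lin c1r.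
  + move=> r v w b _ _; apply: f_inj; rewrite f_lin !f_cup21 f_lin c21l //; exact: f_decomp.
  + move=> w _ r a b; apply: f_inj; rewrite f_lin !f_cup21 f_lin c21r //; exact: f_decomp.
- split; first by move=> *; apply: decompA.
  + move=> r u v w _ _ _; apply: f_inj; rewrite f_lin !f_circ f_lin cil //; exact: f_decomp.
  + move=> r u v w _ _ _; apply: f_inj; rewrite f_lin !f_circ f_lin cir //; exact: f_decomp.
split; first exact: pullback_unitized.
- move=> a b c; apply: f_inj.
  by rewrite f_cup21 (f_cup a b) (linD (@f_lin 2)) (f_cup a (cup1 b c)) (f_cup (cup1 a c) b)
    !f_cup1 ax2.
- move=> u v w z; apply: f_inj.
  by rewrite f_circ (f_cup u v) (f_cup w z) (f_cup (cup1 u w) (cup1 v z))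
    !f_cup1 ax3.
- move=> a c; apply: f_inj.
  by rewrite f_cup1 f_d ax4 (linD (@f_lin 1)) (linN (@f_lin 1)) (f_cup a c) (f_cup c a).
- move=> a b _ _; apply: f_inj; rewrite f_d f_cup1 ax5.
  + rewrite (linD (@f_lin 2)) (linN (@f_lin 2)) !(linD (@f_lin 2)) !(linN (@f_lin 2)).
    by rewrite f_circ !f_cup21 (f_cup a b) (f_cup b a) !f_d.
  + by rewrite -f_d; apply: f_decomp.
  + by rewrite -f_d; apply: f_decomp.
Qed.

End Pullback.

(** * The differential *)

Section Separable.
Variables (k : coef) (X : choiceType).
Local Notation R := (coef_ring k).
Local Notation B := (IntR k X).
Local Notation M := (X -> R).
Local Notation m := (maug k X).
Local Notation ev := (@IntR_eval k X).

Lemma ev_linear a : linear (fun q : B => ev q a : R^o).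
Proof. by move=> c q r; apply: IntR_evalP. Qed.

Lemma ev_sum (I : Type) (s : seq I) (c : I -> R) (e : I -> B) a :
  ev (\sum_(i <- s) c i *: e i) a = \sum_(i <- s) c i * ev (e i) a.
Proof.
rewrite (lin_sum (ev_linear a)); apply: eq_bigr => i _.
exact: (linZ (ev_linear a)).
Qed.

(** The image of Int(R^X) (x) Int(R^X) in the functions of two variables. Full Int(R^X) is used
    instead of m so that functions of one variable alone are included. *)
Definition separable (f : M -> M -> R) : Prop := exists l : seq (B * B),
  forall a a', f a a' = \sum_(p <- l) ev p.1 a * ev p.2 a'.

Lemma separable_mul (q r : B) : separable (fun a a' => ev q a * ev r a').
Proof. by exists [:: (q, r)] => a a'; rewrite big_seq1. Qed.

Lemma separable_comb c f g : separable f -> separable g ->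
  separable (fun a a' => c * f a a' + g a a').
Proof.
move=> [l lE] [l' lE']; exists ([seq (c *: p.1, p.2) | p <- l] ++ l') => a a'.
rewrite big_cat big_map /= lE lE' mulr_sumr; congr (_ + _).
by apply: eq_bigr => p _; rewrite [ev (c *: _) _](linZ (ev_linear a)) mulrA.
Qed.

Lemma separableM f g : separable f -> separable g -> separable (fun a a' => f a a' * g a a').
Proof.
move=> [l lE] [l' lE'].
exists [seq (p.1 * p'.1, p.2 * p'.2) | p <- l, p' <- l'] => a a'.
rewrite big_allpairs_dep lE lE' mulr_suml; apply: eq_bigr => p _.
rewrite mulr_sumr; apply: eq_bigr => p' _.
by rewrite !IntR_evalM; ring.
Qed.

(* Interpolation expresses a separable function through its own values, so a
   common factor of the values divides the coefficients. *)
Lemma separable_div c f : c != 0 -> separable (fun a a' => c * f a a') -> separable f.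
Proof.
move=> c0 [l lE].
have [I [u [e [_ eE]]]] := IntR_interp ([seq p.1 | p <- l] ++ [seq p.2 | p <- l]).
exists [seq (f (u ij.1) (u ij.2) *: e ij.1, e ij.2) | ij <- index_enum (I * I)%type] => a a'.
apply: (coef_mulI c0); rewrite lE big_map /=.
transitivity (\sum_(ij : I * I) \sum_(p <- l)
    (ev p.1 (u ij.1) * ev (e ij.1) a) * (ev p.2 (u ij.2) * ev (e ij.2) a')); last first.
  rewrite mulr_sumr; apply: eq_bigr => -[i j] _ /=.
  rewrite [ev (_ *: _) _](linZ (ev_linear a)) mulrA -[_ *: _]/(_ * _) mulrA lE.
  by rewrite !mulr_suml; apply: eq_bigr => p _; ring.
rewrite exchange_big; apply: eq_big_seq => p pl.
rewrite -(pair_bigA _ (fun i j => (ev p.1 (u i) * ev (e i) a) * (ev p.2 (u j) * ev (e j) a'))).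
rewrite [in LHS](eE p.1) ?[X in _ * ev X _](eE p.2) ?ev_sum; last first.
- by rewrite mem_cat map_f.
- by rewrite mem_cat [X in _ || X]map_f ?orbT.
by rewrite mulr_suml; apply: eq_bigr => i _; rewrite mulr_sumr.
Qed.

Lemma separable_eq f g : (forall a a', f a a' = g a a') -> separable f -> separable g.
Proof. by move=> fg [l lE]; exists l => a a'; rewrite -fg lE. Qed.

Lemma psi_at_linear n s : linear (fun w : tpow m n => psi w s : R^o).
Proof. by move=> c w w'; rewrite psi_linear. Qed.

(** Replacing every factor by its augmentation turns f(a, a') into f(a, a') - f(0, a') - f(a, 0) +
    f(0, 0), and the last three terms vanish. *)
Lemma separable_realized f : separable f ->
    (forall a, f a (fun=> 0) = 0) -> (forall a', f (fun=> 0) a' = 0) ->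
  exists w : tpow m 2, forall s, psi w s = f (s ord0) (s ord_max).
Proof.
move=> [l lE] fr fl; exists (\sum_(p <- l) tens2 (augment p.1) (augment p.2)) => s.
rewrite (lin_sum (psi_at_linear s)).
under eq_bigr => p _ do rewrite psi_tens2 !evm_augment.
transitivity (f (s ord0) (s ord_max) - f (fun=> 0) (s ord_max)
    - f (s ord0) (fun=> 0) + f (fun=> 0) (fun=> 0)); last first.
  by rewrite !fr fl !subr0 addr0.
rewrite !lE -!sumrB -big_split /=; apply: eq_bigr => p _; ring.
Qed.

End Separable.

Section Differential.
Variables (k : coef) (X : choiceType) (tau : X -> tpow (maug k X) 2).
Local Notation R := (coef_ring k).
Local Notation B := (IntR k X).
Local Notation M := (X -> R).
Local Notation m := (maug k X).
Local Notation T := (tpow m).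
Local Notation C := (cochain R M).
Local Notation ev := (@IntR_eval k X).
Local Notation mu := (mu tau).
Local Notation zeroM := ((fun=> 0) : M).

Definition pair2 (a a' : M) : simplex M 2 := fun i => if i == ord0 then a else a'.

Lemma pair2E (s : simplex M 2) : s = pair2 (s ord0) (s ord_max).
Proof.
apply: funext => i; rewrite /pair2; case: eqP => [->//|i0]; congr s; apply: val_inj.
by case: i i0 => -[|[|i]] // lt_i2 i0; case: i0; apply: val_inj.
Qed.

Lemma muE a a' x : mu a a' x = a x + a' x - psi (tau x) (pair2 a a').
Proof. by rewrite -tlift2_evm. Qed.

(** Elements of m vanish at 0. Applied to tau(x), this makes the zero function a two-sided unit. *)
Lemma psi2_0 (w : T 2) s : s ord0 = zeroM \/ s ord_max = zeroM -> psi w s = 0.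
Proof.
move=> s0; apply: (tpow2_ext (f := fun w => psi w s : R^o) (g := fun=> 0)) w.
- exact: psi_at_linear.
- by move=> c w w'; rewrite scaler0 addr0.
by move=> q r; rewrite psi_tens2; case: s0 => ->; rewrite evm0 ?mul0r ?mulr0.
Qed.

Lemma mu0r a : mu a zeroM = a.
Proof. by apply: funext => x; rewrite muE psi2_0 ?subr0 ?addr0 //; right. Qed.

Lemma mu0l a : mu zeroM a = a.
Proof. by apply: funext => x; rewrite muE psi2_0 ?subr0 ?add0r //; left. Qed.

Lemma separable_psi (w : T 2) : separable (fun a a' => psi w (pair2 a a')).
Proof.
elim/tpow_ind: w => [c u v su sv|t].
  apply: separable_eq (separable_comb c su sv) => a a'.
  by rewrite [RHS](psi_at_linear (pair2 a a')).
rewrite [t]tuple2E; set q := tnth t ord0; set r := tnth t ord_max.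
apply: separable_eq (separable_mul (val q) (val r)) => a a'.
by rewrite [RHS]psi_tens2.
Qed.

Lemma separable_eval_mu (q : B) : separable (fun a a' => ev q (mu a a')).
Proof.
apply: (@IntR_ind k X (fun q => separable (fun a a' => ev q (mu a a')))) q; split.
- apply: separable_eq (separable_mul 1 1) => a a'.
  by rewrite !IntR_eval1 mul1r.
- move=> c q r sq sr; apply: separable_eq (separable_comb c sq sr) => a a'.
  by rewrite IntR_evalP.
- move=> q r sq sr; apply: separable_eq (separableM sq sr) => a a'.
  by rewrite IntR_evalM.
- move=> x; pose v := IntR_var k x.
  apply: separable_eq (separable_comb (-1) (separable_psi (tau x))
    (separable_comb 1 (separable_mul v 1) (separable_mul 1 v))) => a a'.
  by rewrite !IntR_eval_var !IntR_eval1 muE; ring.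
- move=> c q c0 sq; apply: (separable_div c0).
  by apply: separable_eq sq => a a'; rewrite [LHS](linZ (ev_linear _)).
Qed.

(** The coboundary is separable, and by the unit laws of mu and q(0) = 0 it vanishes when either
    argument is 0; hence it is realized by a tensor over m. *)
Lemma d_exists_deg1 (q : m) : exists w : T 2, psi w = bar_d mu (psi (iota1 q)).
Proof.
pose f a a' := evm q a' - evm q (mu a a') + evm q a.
have [|||w wE] := @separable_realized k X f.
- apply: separable_eq (separable_comb (-1) (separable_eval_mu (val q))
    (separable_comb 1 (separable_mul (val q) 1) (separable_mul 1 (val q)))) => a a'.
  by rewrite !IntR_eval1 /f /evm; ring.
- by move=> a; rewrite /f mu0r evm0 sub0r addNr.
- by move=> a; rewrite /f mu0l evm0 addr0 subrr.
exists w; apply: funext => s; rewrite wE (bar_d1E _ zeroM).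
by rewrite !psi_iota1.
Qed.

Local Notation A := (tensor_alg k X).
Local Notation BA := (bar_alg k X).

Lemma psi_gcast i j (e : i = j) (u : T i) :
  psi (gcast (A := A) e u) = gcast (A := BA) e (psi u).
Proof. by case: j / e. Qed.

(** Here du and dv are arbitrary, so that the computation serves both the existence and the
    uniqueness of the differential. *)
Lemma psi_cup1_d_rhs (u v : T 1) (du dv : T 2) :
  psi (- tcup u v - tcup v u + tcup21 du v + tcup21 dv u - tcirc du dv)
  = - cochain_cup (psi u) (psi v) - cochain_cup (psi v) (psi u)
    + cochain_cup21 (psi du) (psi v) + cochain_cup21 (psi dv) (psi u)
    - cochain_circ (psi du) (psi dv) :> C 2.
Proof.
apply: etrans (linB5 (@psi_linear k X 2) _ _ _ _ _) _.
have F (a b c d e a' b' c' d' e' : C 2) : a = a' -> b = b' -> c = c' -> d = d' -> e = e' ->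
  - a - b + c + d - e = - a' - b' + c' + d' - e' by move=> -> -> -> -> ->.
exact: (F _ _ _ _ _ _ _ _ _ _ (psi_cup u v) (psi_cup v u) (psi_cup21 du v)
  (psi_cup21 dv u) (psi_circ du dv)).
Qed.

Lemma tuple0E (t : 0.-tuple m) : t = [tuple].
Proof. exact/val_inj/size0nil/size_tuple. Qed.

Lemma tupleSE n (t : n.+1.-tuple m) : t = [tuple of thead t :: behead_tuple t].
Proof. exact: tuple_eta. Qed.

Lemma d_exists_cup i j (u : T i) (v : T j) :
    (exists w : T i.+1, psi w = bar_d mu (psi u)) ->
    (exists w : T j.+1, psi w = bar_d mu (psi v)) ->
  exists w : T (i + j).+1, psi w = bar_d mu (psi (tcup u v)).
Proof.
move=> [w wE] [w' wE'].
exists (tcup w v + (-1) ^+ i *: gcast (A := A) (addnS i j) (tcup u w')).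
rewrite psi_cup [RHS](@bar_leibniz R M mu zeroM i j (psi u) (psi v)).
rewrite (linD (@psi_linear _ _ _)) (linZ (@psi_linear _ _ _)) psi_gcast.
by rewrite (psi_cup w v) (psi_cup u w') wE wE'.
Qed.

Lemma d_exists n (u : T n) : exists w : T n.+1, psi w = bar_d mu (psi u).
Proof.
elim/tpow_ind: u => [c u v [wu wuE] [wv wvE]|t].
  by exists (c *: wu + wv); rewrite !psi_linear bar_linear wuE wvE.
elim: n t => [|n IHn] t.
  by exists 0; rewrite (bar_d0E _ zeroM) (lin0 (@psi_linear _ _ _)).
rewrite (tupleSE t) tens_cons; move: (thead t) (behead_tuple t) => q {}t.
exact: (d_exists_cup (d_exists_deg1 q) (IHn t)).
Qed.

(** Preimages are chosen element by element; injectivity of psi makes them unique, which forces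
    linearity and the other laws. *)
Definition dT : degree1_map A := fun n u => sval (cid (d_exists u)).

Lemma psi_dT n (u : T n) : psi (dT u) = bar_d mu (psi u).
Proof. exact: (svalP (cid (d_exists u))). Qed.

Lemma dT_is_d_tau : is_d_tau tau dT.
Proof.
split.
- move=> n c u v; apply: psi_inj.
  by rewrite psi_linear !psi_dT psi_linear bar_linear.
- move=> x; apply: psi_inj; rewrite psi_dT; apply: funext => s.
  rewrite (bar_d1E _ zeroM) !psi_iota1 /evm !IntR_eval_var muE -pair2E; ring.
- move=> i j u v; apply: psi_inj.
  rewrite (linD (@psi_linear _ _ _)) (linZ (@psi_linear _ _ _)) psi_gcast.
  rewrite psi_dT psi_cup [LHS](@bar_leibniz R M mu zeroM i j (psi u) (psi v)).
  by rewrite (psi_cup (dT u) v) (psi_cup u (dT v)) !psi_dT.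
- move=> u v; apply: psi_inj.
  rewrite psi_dT psi_cup1 [LHS](@bar_cup1_d R M mu zeroM (psi u) (psi v)).
  by rewrite [RHS]psi_cup1_d_rhs !psi_dT.
Qed.

(** * Uniqueness of the differential *)

Section Uniqueness.
Variable d : degree1_map A.
Hypothesis d_tauP : is_d_tau tau d.

(** The laws imposed on d close this set under every operation that builds the tensor algebra from
    X. Once it is everything, injectivity of psi determines d. *)
Let real n (u : T n) : Prop := psi (d u) = bar_d mu (psi u).

Lemma real_lin n c (u v : T n) : real u -> real v -> real (c *: u + v).
Proof.
have [d_lin _ _ _] := d_tauP; rewrite /real => ru rv.
by rewrite d_lin !psi_linear bar_linear ru rv.
Qed.

Lemma real_cup i j (u : T i) (v : T j) : real u -> real v -> real (tcup u v).
Proof.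
have [_ _ leib _] := d_tauP; rewrite /real => ru rv.
rewrite psi_cup [RHS](@bar_leibniz R M mu zeroM i j (psi u) (psi v)).
rewrite [d _](leib i j u v) (linD (@psi_linear _ _ _)) (linZ (@psi_linear _ _ _)).
by rewrite psi_gcast (psi_cup (d u) v) (psi_cup u (d v)) ru rv.
Qed.

(** The Leibniz rule for 1 = 1 U 1 reads d 1 = d 1 + d 1. *)
Lemma real_one : real (tens [tuple]).
Proof.
have [d_lin _ leib _] := d_tauP; rewrite /real (bar_d0E _ zeroM).
set e : A 0 := tens [tuple].
have ee : tcup e e = e by rewrite tcup_tens; congr tens; apply: val_inj.
have := leib 0 0 e e; rewrite [cup e e]ee => /(congr1 (@psi _ _ _)).
rewrite (linD (@psi_linear _ _ _)) expr0 scale1r psi_gcast.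
rewrite (psi_cup (d e) e) (psi_cup e (d e)) psi_one.
move: (psi (d e)) => z zE; apply: (cochainP zeroM) => s.
have := congr1 (fun f : C 1 => f (restr 1 s)) zE.
rewrite -[(_ + _) _]/(cochain_cup z (fun=> 1) (restr (1 + 0) s)
  + gcast (A := BA) (addnS 0 0) (cochain_cup (fun=> 1) z) (restr 1 s)).
rewrite bar_gcastE cochain_cupE cochain_cupE mulr1 mul1r => zz.
apply: (addrI (z (restr 1 s))); exact: (etrans (esym zz) (esym (addr0 _))).
Qed.

Lemma real_cup1 (u v : T 1) : real u -> real v -> real (tcup1 u v).
Proof.
have [_ _ _ cup1d] := d_tauP; rewrite /real => ru rv.
rewrite psi_cup1 [RHS](@bar_cup1_d R M mu zeroM (psi u) (psi v)) [d _](cup1d u v).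
by rewrite [LHS]psi_cup1_d_rhs ru rv.
Qed.

(** Induction over a pure subalgebra. Values on X are prescribed, products use the [cup1]-[d]
    formula, and a nonzero scalar can be cancelled because cochains take values in a domain; the
    last point reaches the zeta_n(x). *)
Lemma real_iota1 (q : m) : real (iota1 q).
Proof.
have [d_lin dx _ _] := d_tauP.
have realL c q1 q2 : real (iota1 q1) -> real (iota1 q2) -> real (iota1 (c *: q1 + q2)).
  by move=> r1 r2; rewrite iota1_linear; apply: real_lin.
have realM q1 q2 : real (iota1 q1) -> real (iota1 q2) -> real (iota1 (maug_mul q1 q2)).
  by move=> r1 r2; rewrite -tcup1_iota1; apply: real_cup1.
suff Paug (b : B) : real (iota1 (augment b)) by rewrite -[q]augmentK.
apply: (@IntR_ind k X (fun b => real (iota1 (augment b)))) b; split.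
- have -> : augment (1 : B) = 0 by apply: val_inj; rewrite /= IntR_eval1 scale1r subrr.
  rewrite (lin0 (@iota1_linear k X)) /real (lin0 (d_lin 1%N)) !(lin0 (@psi_linear _ _ _)).
  exact/esym/lin0/bar_linear.
- by move=> c b b' rb rb'; rewrite augment_linear; apply: realL.
- move=> b b' rb rb'.
  (* Expansion of (b(0) + augment b)(b'(0) + augment b') without its constant term. *)
  have -> : augment (b * b') = ev b zeroM *: augment b'
      + (ev b' zeroM *: augment b + maug_mul (augment b) (augment b')).
    apply: val_inj; rewrite /= IntR_evalM; move: (ev b zeroM) (ev b' zeroM) => c c'.
    rewrite -scalerA -(mulr_algl c (c' *: 1)) -(mulr_algl c (b' - _)) -(mulr_algl c' (b - _)).
    by move: (c *: 1) (c' *: 1) => x x'; ring.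
  by apply: (realL _ _ _ rb'); apply: (realL _ _ _ rb); apply: realM.
- move=> x; have -> : augment (IntR_var k x) = maug_var k x.
    by apply: val_inj; rewrite /= IntR_eval_var scale0r subr0.
  rewrite /real dx; apply: funext => s.
  by rewrite (bar_d1E _ zeroM) !psi_iota1 /evm !IntR_eval_var muE -pair2E; ring.
- move=> c b c0; rewrite (linZ (@augment_linear k X)) (linZ (@iota1_linear k X)).
  rewrite /real (linZ (d_lin 1%N)) !(linZ (@psi_linear _ _ _)) (linZ (@bar_linear _ _ _ _)).
  move=> E; apply: funext => s; apply: (coef_mulI c0).
  exact: (congr1 (fun f : C 2 => f s) E).
Qed.

Lemma psi_d_tau n (u : T n) : real u.
Proof.
elim/tpow_ind: u => [c u v|t]; first exact: real_lin.
elim: n t => [|n IHn] t; first by rewrite (tuple0E t); apply: real_one.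
rewrite (tupleSE t) tens_cons.
exact: (real_cup (real_iota1 (thead t)) (IHn (behead_tuple t))).
Qed.

End Uniqueness.

Lemma d_tau_spec : unique (is_d_tau tau) (d_tau tau).
Proof.
have d_tauP : is_d_tau tau (d_tau tau).
  rewrite /d_tau; case: pselect => [ex|[]]; first by case: (cid ex).
  by exists dT; apply: dT_is_d_tau.
split=> // d dP; apply: functional_extensionality_dep => n; apply: funext => u.
by apply: psi_inj; rewrite !psi_d_tau.
Qed.

Lemma psi_d n (u : A n) : psi (d_tau tau u) = d_bar tau (psi u).
Proof. by have [d_tauP _] := d_tau_spec; apply: psi_d_tau. Qed.

End Differential.

(** * Binomial structures *)

Section BinomialStructures.
Variables (k : coef) (X : choiceType).
Local Notation R := (coef_ring k).
Local Notation M := (X -> R).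
Local Notation m := (maug k X).
Local Notation A := (tensor_alg k X).
Local Notation BA := (bar_alg k X).
Local Notation zeroM := ((fun=> 0) : M).

Lemma simplex0E (s : simplex M 0) : s = fun=> zeroM.
Proof. by apply: funext => -[]. Qed.

Lemma coef_binomial_fun n : zeta_range k n ->
  exists w : R -> R, forall r, w r *+ n`! = \prod_(i < n) (r - i%:R).
Proof.
by move=> n_k; have [w wE] := choice (fun r => coef_binomial r n_k); exists w.
Qed.

Lemma bar_deg0_binomial : binomial_algebra (gr1 BA) (fun a b : BA 0 => cup a b : BA 0).
Proof.
apply: (@binomial_algebra_chi k (BA 0) _ _ unit (fun _ f => f (fun=> zeroM))) => //.
- by move=> f g fg; apply: funext => s; rewrite (simplex0E s); apply: (fg tt).
- move=> f n n_k; have [w wE] := coef_binomial (f (fun=> zeroM)) n_k.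
  by exists (fun=> w).
Qed.

(** R (+) C^1 is viewed as the functions on the edges together with one extra point [None], at which
    cochains are taken to be 0; the extra point recovers the R-component. *)
Definition bar_chi (i : option (simplex M 1)) (x : unitized BA) : R :=
  if i is Some s then x.1 + x.2 s else x.1.

Lemma bar_chiP i c x y : bar_chi i (c *: x + y) = c * bar_chi i x + bar_chi i y.
Proof.
case: i => [s|//]; rewrite -[LHS]/(c * x.1 + y.1 + (c * x.2 s + y.2 s)) /=; ring.
Qed.

Lemma bar_chiM i x y : bar_chi i (umul x y) = bar_chi i x * bar_chi i y.
Proof.
case: i => [s|//].
rewrite -[LHS]/(x.1 * y.1 + (x.1 * y.2 s + y.1 * x.2 s + x.2 s * y.2 s)) /=; ring.
Qed.

Lemma bar_chi1 i : bar_chi i (uone BA) = 1.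
Proof. by case: i => [s|//]; rewrite /bar_chi /= addr0. Qed.

Lemma bar_chi_inj x y : (forall i, bar_chi i x = bar_chi i y) -> x = y.
Proof.
case: x y => [r f] [r' g] fg; have rE : r = r' := fg None; congr pair => //.
by apply: funext => s; have := fg (Some s); rewrite /= rE => /addrI.
Qed.

Lemma bar_chi_binomial x n : zeta_range k n -> exists z, forall i,
  bar_chi i z *+ n`! = \prod_(j < n) (bar_chi i x - j%:R).
Proof.
move=> /coef_binomial_fun[w wE].
(* The binomial is taken pointwise, then split into its value at the extra point and the difference
   from that value. *)
exists ((w x.1, fun s => w (x.1 + x.2 s) - w x.1) : unitized BA) => -[s|]; last exact: wE.
by rewrite /= addrC subrK wE.
Qed.

Lemma tensor_deg0_binomial : binomial_algebra (gr1 A) (fun a b : A 0 => cup a b : A 0).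
Proof.
pose chi (_ : unit) (u : A 0) : R := psi u (fun=> zeroM).
have chiL i c u v : chi i (c *: u + v) = c * chi i u + chi i v.
  exact: (psi_at_linear (fun=> zeroM)).
have chi1 i : chi i (gr1 A) = 1 by rewrite /chi psi_one.
apply: (@binomial_algebra_chi k (A 0) _ _ unit chi) => //.
- move=> i u v; rewrite /chi (psi_cup u v) /cochain_cup.
  by congr (psi u _ * psi v _); apply: simplex0E.
- move=> u v uv; apply: psi_inj; apply: funext => s; rewrite (simplex0E s).
  exact: (uv tt).
- move=> u n n_k; have [w wE] := coef_binomial (chi tt u) n_k.
  exists (w *: gr1 A) => -[]; rewrite -[w *: _]addr0 chiL chi1 mulr1.
  have -> : chi tt 0 = 0 by exact: (lin0 (psi_at_linear (fun=> zeroM))).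
  by rewrite addr0.
Qed.

(** The unitization of T^1 is Int(R^X) with its evaluations. The zero function takes the part of the
    extra point, since elements of m vanish there. *)
Definition tensor_chi (a : M) (x : unitized A) : R := x.1 + evm (deg1 x.2) a.

Lemma tensor_chiP a c x y :
  tensor_chi a (c *: x + y) = c * tensor_chi a x + tensor_chi a y.
Proof.
rewrite /tensor_chi -[(c *: x + y).1]/(c * x.1 + y.1) -[(c *: x + y).2]/(c *: x.2 + y.2).
by rewrite deg1_linear evmP; ring.
Qed.

Lemma evm_linear a : linear (fun q : m => evm q a : R^o).
Proof. by move=> c q r; apply: evmP. Qed.

Lemma tensor_chiM a x y : tensor_chi a (umul x y) = tensor_chi a x * tensor_chi a y.
Proof.
have chi_lin : linear (fun u : A 1 => evm (deg1 u) a : R^o).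
  by move=> c u v; rewrite deg1_linear; apply: evm_linear.
rewrite /tensor_chi; set u := x.2; set v := y.2.
have -> : evm (deg1 (umul x y).2) a = x.1 * evm (deg1 v) a + y.1 * evm (deg1 u) a
    + evm (deg1 u) a * evm (deg1 v) a.
  apply: etrans (linD chi_lin _ _) _; congr (_ + _).
    apply: etrans (linD chi_lin _ _) _; congr (_ + _); exact: (linZ chi_lin).
  by rewrite [cup1 _ _]/(tcup1 _ _) /= iota1K evmM.
rewrite /=; ring.
Qed.

Lemma tensor_chi1 a : tensor_chi a (uone A) = 1.
Proof.
rewrite /tensor_chi /= (lin0 (@deg1_linear k X)).
by rewrite [evm _ _](lin0 (evm_linear a)) addr0.
Qed.

Lemma tensor_chi_inj x y : (forall a, tensor_chi a x = tensor_chi a y) -> x = y.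
Proof.
case: x y => [r u] [r' v] uv; have := uv zeroM; rewrite /tensor_chi /= !evm0 !addr0 => rE.
congr pair => //; apply: psi_inj; apply: funext => s; rewrite !psi1E.
by have := uv (s ord0); rewrite /tensor_chi /= rE => /addrI.
Qed.

(** Interpolation writes g = b (b - 1) .. (b - n + 1) with its own values as coefficients. Each
    value is n! times an element of R, so dividing the coefficients by n! produces zeta_n(b) inside
    Int(R^X). *)
Lemma tensor_chi_binomial x n : zeta_range k n -> exists z, forall a,
  tensor_chi a z *+ n`! = \prod_(j < n) (tensor_chi a x - j%:R).
Proof.
move=> /coef_binomial_fun[w wE].
pose b : IntR k X := x.1 *: 1 + val (deg1 x.2).
have bE a : IntR_eval b a = tensor_chi a x by rewrite IntR_evalP IntR_eval1 mulr1.
pose g := \prod_(j < n) (b - j%:R).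
have gE a : IntR_eval g a = \prod_(j < n) (tensor_chi a x - j%:R).
  rewrite (big_morph (fun q => IntR_eval q a) (fun q r => IntR_evalM q r a) (IntR_eval1 a)).
  apply: eq_bigr => j _; rewrite addrC -scaler_nat -scaleN1r scalerA IntR_evalP.
  by rewrite IntR_eval1 bE mulr1 mulN1r addrC.
have [I [a [e [_ eE]]]] := IntR_interp [:: g].
pose z := \sum_i w (tensor_chi (a i) x) *: e i.
exists ((IntR_eval z zeroM, iota1 (augment z)) : unitized A) => a'.
rewrite /tensor_chi /= iota1K evm_augment addrC subrK -gE (eE g (mem_head _ _)).
rewrite !ev_sum -sumrMnl; apply: eq_bigr => i _.
by rewrite gE -wE mulrnAl.
Qed.

Lemma tensor_decomp (w : A 2) : w \in @decomp R A.
Proof.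
have [[_ SD] SZ] := lspan_closed (fun w : A 2 => exists a b : A 1, w = cup a b).
elim/tpow_ind: w => [c u v Su Sv|t]; first by apply: (SD) => //; apply: (SZ).
apply/asboolP; exists [:: (1, tens t)]; rewrite big_seq1 scale1r; split=> // rg.
rewrite inE => /eqP->; exists (iota1 (tnth t ord0)), (iota1 (tnth t ord_max)).
by rewrite [RHS]tcup_iota1 /= {1}[t]tuple2E.
Qed.

End BinomialStructures.

(** * The embedding of the tensor algebra into the bar cochains *)

Theorem theorem1p2 (k : coef) (X : choiceType) (tau : X -> tpow (maug k X) 2) :
  admissible tau ->
  [/\ unique (is_d_tau tau) (d_tau tau),
      forall n (u : tensor_alg k X n), d_tau tau (d_tau tau u) = 0,
      is_binomial_cupone_dga (d_tau tau),
      is_binomial_cupone_dga (d_bar tau)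
    & exists psi : forall n, tensor_alg k X n -> bar_alg k X n,
      [/\ is_morphism (d_tau tau) (d_bar tau) psi,
          extends_eval psi,
          forall n, injective (psi n)
        & forall psi' : forall n, tensor_alg k X n -> bar_alg k X n,
            is_morphism (d_tau tau) (d_bar tau) psi' ->
            extends_eval psi' -> forall n u, psi' n u = psi n u]].
Proof.
move=> tau_adm.
have bar_dga : is_cupone_dga (d_bar tau).
  exact: (bar_is_cupone_dga (coef_ring k) (fun=> 0) tau_adm).
have tensor_dga : is_cupone_dga (d_tau tau).
  exact: (@pullback_cupone_dga _ (tensor_alg k X) (bar_alg k X) (d_tau tau) (d_bar tau)
    (@psi k X) (@psi_linear k X) (@psi_inj k X) (@psi_one k X) (@psi_cup k X) (@psi_cup1 k X)
    (@psi_cup21 k X) (@psi_circ k X) (@psi_d k X tau) (@tensor_decomp k X) bar_dga).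
split.
- exact: d_tau_spec.
- by have [[_ _ dd _] _ _ _] := tensor_dga.
- split; [exact: tensor_dga|exact: tensor_deg0_binomial|].
  exact: (binomial_algebra_chi (@tensor_chiP k X) (@tensor_chiM k X) (@tensor_chi1 k X)
    (@tensor_chi_inj k X) (@tensor_chi_binomial k X)).
- split; [exact: bar_dga|exact: bar_deg0_binomial|].
  exact: (binomial_algebra_chi (@bar_chiP k X) (@bar_chiM k X) (@bar_chi1 k X)
    (@bar_chi_inj k X) (@bar_chi_binomial k X)).
exists (@psi k X); split.
- split.
  + by split; [exact: psi_linear | exact: psi_one].
  + exact: psi_cup.
  + exact: psi_d.
  + exact: psi_cup1.
  move=> n u n_k.
  (* [zeta1] is computed in the unitization, so psi is extended by the identity of R to a unital map
     there. *)
  pose F (x : unitized (tensor_alg k X)) : unitized (bar_alg k X) := (x.1, psi x.2).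
  have F0 : F (0, u) = (0, psi u) by [].
  rewrite -[LHS]/((F (zeta _ _ n (0, u))).2) /zeta1 -F0; congr snd.
  apply: zeta_morphism.
  + by move=> x y; congr pair; rewrite /= (linD (@psi_linear _ _ _)).
  + move=> x y; congr pair; rewrite /= !(linD (@psi_linear _ _ _)) psi_cup1.
    by rewrite !(linZ (@psi_linear _ _ _)).
  + by congr pair; rewrite /= (lin0 (@psi_linear _ _ _)).
  + exact: (falling_divisible (@tensor_chiP k X) (@tensor_chiM k X) (@tensor_chi1 k X)
      (@tensor_chi_inj k X) (@tensor_chi_binomial k X)).
  + by move=> x y; apply: (chi_fact_inj (@bar_chiP k X) (@bar_chi_inj k X) n_k).
- by move=> q s; rewrite psi_iota1.
- exact: psi_inj.
(* A unital linear map compatible with cup products is determined by its degree-one part, as every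
   pure tensor is a cup product of elements of degree one. *)
move=> psi' [[psi'_lin psi'_one] psi'_cup _ _ _] psi'_ev n.
apply: tpow_ext => [||t]; [exact: psi'_lin|exact: psi_linear|].
elim: n t => [|n IHn] t.
  by rewrite (tuple0E t) psi_one; apply: psi'_one.
rewrite (tupleSE t) tens_cons (psi_cup (iota1 _) (tens _)).
have := psi'_cup 1%N n (iota1 (thead t)) (tens (behead_tuple t)) => ->.
have E : psi' 1%N (iota1 (thead t)) = psi (iota1 (thead t)).
  by apply: funext => s; rewrite psi'_ev psi_iota1.
by rewrite IHn E.
Qed.
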